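(* Let $k\ge1$ be an integer, $c\in\mathbb{C}$ a constant and $\beta\in\mathbb{R}$ with $|\beta|\ge1$. There is a bounded linear operator $T_k:L^2(\mathbb{C},e^{-|z|^2})\to L^2(\mathbb{C},e^{-|z|^2})$ such that $$(\beta\,\bar\partial^k+c)\,T_k=I,$$ with operator norm satisfying $\|T_k\|^2\le\dfrac{1}{k!}$.
   Context: $\bar\partial=\partial/\partial\bar z$, $\bar\partial^k$ is its $k$-th iterate, and $d\sigma$ is Lebesgue measure on $\mathbb{C}$. $L^2(\mathbb{C},e^{-|z|^2})$ is the Hilbert space of $f\in L^2_{loc}(\mathbb{C})$ with $\|f\|^2=\int_{\mathbb{C}}|f|^2e^{-|z|^2}d\sigma<\infty$. A function $u\in L^2_{loc}(\mathbb{C})$ is a weak solution of $\beta\bar\partial^ku+cu=g$ if $\int_{\mathbb{C}}u\,\big((-1)^k\beta\,\bar\partial^k\phi+c\,\phi\big)d\sigma=\int_{\mathbb{C}}g\phi\,d\sigma$ for all smooth compactly supported $\phi:\mathbb{C}\to\mathbb{C}$. The identity $(\beta\bar\partial^k+c)T_k=I$ means that for every $f\in L^2(\mathbb{C},e^{-|z|^2})$, $u=T_kf$ is a weak solution of $\beta\bar\partial^ku+cu=f$. *)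

(* Defs.v *)
From mathcomp Require Import all_boot all_order all_algebra.
From mathcomp Require Import all_classical all_reals all_analysis.
From mathcomp Require Import complex.

Set Implicit Arguments.
Unset Strict Implicit.
Unset Printing Implicit Defensive.

Import Order.TTheory GRing.Theory Num.Theory.
Import numFieldNormedType.Exports.

Local Open Scope classical_set_scope.
Local Open Scope ring_scope.
Local Open Scope complex_scope.

(* R[i] carries neither a sigma-algebra nor a topology over R in the libraries,
   so its measure, topology and real differential calculus are those of R * R,
   read through (x, y) |-> x + i y. Functions remain functions R[i] -> R[i]. *)

Notation plane R := (measurableTypeR R * measurableTypeR R)%type.

Definition cplx (R : realType) (p : R * R) : R[i] := p.1 +i* p.2.

Definition dsigma (R : realType) : {measure set (plane R) -> \bar R} :=
  (@lebesgue_measure R \x @lebesgue_measure R)%E.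

Definition re_part (R : realType) (f : R[i] -> R[i]) (p : R * R) : R :=
  complex.Re (f (cplx p)).

Definition im_part (R : realType) (f : R[i] -> R[i]) (p : R * R) : R :=
  complex.Im (f (cplx p)).

(* The real-valued modulus (the norm of R[i] as a numFieldType is R[i]-valued). *)
Definition modulus (R : realType) (z : R[i]) : R := ComplexField.Normc.normc z.

Definition cmeasurable (R : realType) (f : R[i] -> R[i]) : Prop :=
  measurable_fun [set: plane R] (re_part f) /\
  measurable_fun [set: plane R] (im_part f).

Definition ae_equal (R : realType) (f g : R[i] -> R[i]) : Prop :=
  {ae @dsigma R, forall p, f (cplx p) = g (cplx p)}.

Definition cintegral (R : realType) (h : R[i] -> R[i]) : R[i] :=
  (\int[@dsigma R]_p re_part h p) +i* (\int[@dsigma R]_p im_part h p).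

Definition L2loc (R : realType) (f : R[i] -> R[i]) : Prop :=
  cmeasurable f /\
  forall K : set (R * R), compact K ->
    (\int[@dsigma R]_(p in K) (modulus (f (cplx p)) ^+ 2)%:E < +oo)%E.

Definition sqnormw (R : realType) (f : R[i] -> R[i]) : \bar R :=
  (\int[@dsigma R]_p
     (modulus (f (cplx p)) ^+ 2 * expR (- modulus (cplx p) ^+ 2))%:E)%E.

Definition normw (R : realType) (f : R[i] -> R[i]) : \bar R :=
  (sqnormw f `^ 2^-1)%E.

(* Representatives of the elements of L^2(C, e^{-|z|^2}); the elements
   themselves are the classes modulo ae_equal. *)
Definition L2w (R : realType) (f : R[i] -> R[i]) : Prop :=
  L2loc f /\ (sqnormw f < +oo)%E.

Definition axis (R : realType) (b : bool) : R * R := if b then (0, 1) else (1, 0).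

(* C^oo: the iterated partial derivatives, taken in any order (word s), all
   exist and are continuous. *)
Definition smooth_real (R : realType) (g : R * R -> R) : Prop :=
  forall s : seq bool,
    let h := foldr (fun b (h : R * R -> R) => 'D_(axis R b) h) g s in
    continuous h /\ forall p b, derivable h p (axis R b).

Definition smooth (R : realType) (f : R[i] -> R[i]) : Prop :=
  smooth_real (re_part f) /\ smooth_real (im_part f).

Definition compactly_supported (R : realType) (f : R[i] -> R[i]) : Prop :=
  compact (closure [set p : R * R | f (cplx p) <> 0]).

Definition partial (R : realType) (b : bool) (f : R[i] -> R[i]) (z : R[i]) : R[i] :=
  ('D_(axis R b) (re_part f) (complex.Re z, complex.Im z)) +i*
  ('D_(axis R b) (im_part f) (complex.Re z, complex.Im z)).

(* d/d(conj z) = (d/dx + i d/dy) / 2 *)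
Definition dbar (R : realType) (f : R[i] -> R[i]) (z : R[i]) : R[i] :=
  2^-1 * (partial false f z + (0 +i* 1) * partial true f z).

(* u is a weak solution of beta dbar^k u + c u = g *)
Definition weak_solution (R : realType) (k : nat) (beta : R) (c : R[i])
    (u g : R[i] -> R[i]) : Prop :=
  L2loc u /\
  forall phi : R[i] -> R[i], smooth phi -> compactly_supported phi ->
    cintegral (fun z =>
      u z * ((-1) ^+ k * beta%:C * iter k (@dbar R) phi z + c * phi z)) =
    cintegral (fun z => g z * phi z).

(* T induces a C-linear operator on the quotient of L2w by ae_equal. *)
Definition linear_L2w (R : realType)
    (T : (R[i] -> R[i]) -> (R[i] -> R[i])) : Prop :=
  [/\ forall f, L2w f -> L2w (T f),
      forall f g, L2w f -> L2w g -> ae_equal f g -> ae_equal (T f) (T g)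
    & forall (a : R[i]) f g, L2w f -> L2w g ->
        ae_equal (T (fun z => a * f z + g z)) (fun z => a * T f z + T g z)].

Definition bounded_L2w (R : realType)
    (T : (R[i] -> R[i]) -> (R[i] -> R[i])) : Prop :=
  exists M : R, forall f, L2w f -> (normw (T f) <= M%:E * normw f)%E.

Definition opnorm (R : realType)
    (T : (R[i] -> R[i]) -> (R[i] -> R[i])) : \bar R :=
  ereal_sup [set normw (T f) | f in [set f | L2w f /\ (normw f <= 1)%E]].

(* Main.v *)
Require Import Defs.
From mathcomp Require Import all_boot all_order all_algebra.
From mathcomp Require Import all_classical all_reals all_analysis.
From mathcomp Require Import measurable_realfun complex ring lra.

(* Hormander's duality argument. In L^2(exp |z|^2) the operator D = - dbar has
   adjoint D' = d/dz + conj z, and [D', D] = 1. Commuting D' through powers of D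
   gives, for test functions phi,
     |D^k phi|^2 >= |D'^k phi|^2 + k! |phi|^2,
   and the constant c, whose adjoint is conj c, contributes the same cross terms
   to both sides, so
     |(beta D^k + c) phi|^2 >= beta^2 k! |phi|^2 >= k! |phi|^2.
   Now beta D^k + c is the transpose of beta dbar^k + c, and
   phi |-> conj phi * exp |z|^2 is an antilinear isometry onto
   L^2(exp (- |z|^2)) that turns the weighted inner product into the bilinear
   pairing \int u phi. The estimate bounds phi |-> \int f phi on the range of
   the transpose, and the Riesz representation of this functional by an element
   of the closure of the range is the minimal solution T f; it depends linearly
   on f and |T f|^2 <= |f|^2 / k!. *)

Set Implicit Arguments.
Unset Strict Implicit.
Unset Printing Implicit Defensive.

Import Order.TTheory GRing.Theory Num.Theory.
Import numFieldNormedType.Exports.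

Local Open Scope classical_set_scope.
Local Open Scope ring_scope.
Local Open Scope complex_scope.

(** * Partial derivatives of real functions on the plane *)

Section PartialDerivatives.
Context {R : realType}.
Implicit Types (g h : R * R -> R) (p : R * R) (b : bool).

(** The estimate controls only test functions, and T f is picked by choice for each f separately, so
    neither linearity nor independence of the representative is built in. Both come from uniqueness:
    two minimal solutions with the same data differ by a null function. Elements stay functions
    rather than classes: the inner products are only semidefinite, and their linearity is stated on
    a predicate of square integrable functions. They are real-valued, namely real parts of Hermitian
    products, so that minimization and discriminants are arguments in an ordered field; complex
    scalars re-enter through the rule that moves a scalar across the product as its conjugate. The
    representing element is obtained by minimizing |A x|^2 - 2 ell x, which the estimate bounds
    below, so that the only Hilbert space input is completeness for sequences with a geometric
    rate. *)

Definition pcoord b p : R := if b then p.2 else p.1.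

Definition slice b p (t : R) : R * R := if b then (p.1, t) else (t, p.2).

Lemma slice_pcoord b p : slice b p (pcoord b p) = p.
Proof. by case: b p => -[]. Qed.

Lemma pcoord_slice b p t : pcoord b (slice b p t) = t.
Proof. by case: b. Qed.

Lemma slice_slice b p t : slice b (slice b p t) = slice b p.
Proof. by case: b. Qed.

Lemma continuous_pcoord b : continuous (pcoord b).
Proof. by case: b => p; [exact: cvg_snd|exact: cvg_fst]. Qed.

Lemma continuous_slice b p : continuous (slice b p).
Proof.
case: b => t.
- by apply: (@cvg_pair _ _ _ _ (nbhs p.1) (nbhs t)); [exact: cvg_cst|exact: cvg_id].
- by apply: (@cvg_pair _ _ _ _ (nbhs t) (nbhs p.2)); [exact: cvg_id|exact: cvg_cst].
Qed.

Let shift_axis b p (t : R) :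
  t *: axis R b + p = slice b p (t *: 1 + pcoord b p) :> R * R.
Proof.
case: b p => -[x y]; rewrite /axis /slice /pcoord /=;
  by congr (_, _) => /=; rewrite ?scaler0 ?add0r.
Qed.

Let quotientE g b p :
  (fun t : R => t^-1 *: ((g \o shift p) (t *: axis R b) - g p)) =
  (fun t => t^-1 *: ((g \o slice b p \o shift (pcoord b p)) (t *: (1 : R)) -
     (g \o slice b p) (pcoord b p))).
Proof.
by apply/funext => t /=; rewrite shift_axis slice_pcoord.
Qed.

(** An equality of propositions, because the two difference quotients are the same function of t;
    one-variable calculus then applies by rewriting. *)
Lemma derivable_slice g b p :
  derivable g p (axis R b) = derivable (g \o slice b p) (pcoord b p) 1.
Proof. by rewrite /derivable quotientE. Qed.

Lemma derive_slice g b p :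
  'D_(axis R b) g p = 'D_1 (g \o slice b p) (pcoord b p).
Proof. by rewrite /derive quotientE. Qed.

Lemma is_derive_sliceP g b p d :
  is_derive p (axis R b) g d <->
  is_derive (pcoord b p) 1 (g \o slice b p) d.
Proof.
by split=> -[gd <-]; split; rewrite ?derivable_slice ?derive_slice //;
  rewrite -derivable_slice.
Qed.

Lemma is_derive_pcoord b b' p :
  is_derive p (axis R b) (pcoord b') (if b == b' then 1 else 0).
Proof.
apply/is_derive_sliceP; case: b b' => -[] /=.
- exact: is_derive_id.
- exact: is_derive_cst.
- exact: is_derive_cst.
- exact: is_derive_id.
Qed.

(** Smoothness quantifies over words of derivatives, and induction on a word needs a class of
    functions stable under differentiation. Exhibiting such a class is how constants, coordinates,
    sums and products are treated. *)
Lemma smooth_real_coind (C : (R * R -> R) -> Prop) :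
  (forall g, C g -> [/\ continuous g,
    forall p b, derivable g p (axis R b) & forall b, C ('D_(axis R b) g)]) ->
  forall g, C g -> smooth_real g.
Proof.
move=> Ccoind g Cg s h; have Ch : C h.
  by rewrite {}/h; elim: s => [//|b s IHs] /=; have [] := Ccoind _ IHs.
by have [] := Ccoind _ Ch.
Qed.

Lemma smooth_real_continuous g : smooth_real g -> continuous g.
Proof. by move=> /(_ [::]) []. Qed.

Lemma smooth_real_derivable g p b : smooth_real g -> derivable g p (axis R b).
Proof. by move=> /(_ [::]) []. Qed.

Lemma smooth_real_derive g b : smooth_real g -> smooth_real ('D_(axis R b) g).
Proof. by move=> gs s /=; have := gs (rcons s b); rewrite foldr_rcons. Qed.

Lemma smooth_real_cst (a : R) : smooth_real (cst a : R * R -> R).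
Proof.
apply: (@smooth_real_coind (fun g => exists a, g = cst a)); last by exists a.
move=> _ [{}a ->]; split=> [p|p b|b].
- exact: cvg_cst.
- exact: derivable_cst.
- by exists 0; apply/funext => p; rewrite derive_cst.
Qed.

Lemma smooth_real_pcoord b : smooth_real (pcoord b).
Proof.
apply: (@smooth_real_coind
  (fun g => g = pcoord b \/ smooth_real g)); last by left.
move=> g [->|gs].
  split=> [|p b'|b']; first exact: continuous_pcoord.
    by have [] := is_derive_pcoord b' b p.
  right; suff -> : 'D_(axis R b') (pcoord b) = cst (if b' == b then 1 else 0).
    exact: smooth_real_cst.
  by apply/funext => p; have := is_derive_pcoord b' b p => /@derive_val.
split=> [|p b'|b']; first exact: smooth_real_continuous.
  exact: smooth_real_derivable.
by right; exact: smooth_real_derive.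
Qed.

(** Differentiating a product gives a sum of products, so products of two smooth functions do not
    form a class visibly stable under differentiation; the ring generated by the smooth functions
    does. *)
Inductive smooth_ring : (R * R -> R) -> Prop :=
| smooth_ring_base g : smooth_real g -> smooth_ring g
| smooth_ring_add g h : smooth_ring g -> smooth_ring h -> smooth_ring (g \+ h)
| smooth_ring_mul g h : smooth_ring g -> smooth_ring h -> smooth_ring (g \* h).

Let smooth_ring_smooth g : smooth_ring g -> smooth_real g.
Proof.
apply: (@smooth_real_coind smooth_ring) => {}g; elim=> {g} [g gs|g h rg [gc gd gD] rh [hc hd hD]
  |g h rg [gc gd gD] rh [hc hd hD]].
- split=> [|p b|b]; first exact: smooth_real_continuous.
    exact: smooth_real_derivable.
  by apply: smooth_ring_base; exact: smooth_real_derive.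
- split=> [p|p b|b]; first by apply: cvgD; [exact: gc|exact: hc].
    by apply: derivableD.
  suff -> : 'D_(axis R b) (g \+ h) = 'D_(axis R b) g \+ 'D_(axis R b) h.
    exact: smooth_ring_add.
  by apply/funext => p; rewrite deriveD.
- split=> [p|p b|b]; first by apply: cvgM; [exact: gc|exact: hc].
    by apply: derivableM.
  suff -> : 'D_(axis R b) (g \* h) =
      (g \* 'D_(axis R b) h) \+ (h \* 'D_(axis R b) g).
    by apply: smooth_ring_add; apply: smooth_ring_mul.
  by apply/funext => p; rewrite deriveM.
Qed.

Lemma smooth_realD g h : smooth_real g -> smooth_real h ->
  smooth_real (fun p => g p + h p).
Proof.
by move=> gs hs; apply/smooth_ring_smooth/smooth_ring_add;
  exact: smooth_ring_base.
Qed.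

Lemma smooth_realM g h : smooth_real g -> smooth_real h ->
  smooth_real (fun p => g p * h p).
Proof.
by move=> gs hs; apply/smooth_ring_smooth/smooth_ring_mul;
  exact: smooth_ring_base.
Qed.

Lemma smooth_realZ (a : R) g : smooth_real g -> smooth_real (fun p => a * g p).
Proof. by move=> gs; exact: (smooth_realM (smooth_real_cst a) gs). Qed.

Lemma smooth_realN g : smooth_real g -> smooth_real (fun p => - g p).
Proof.
move=> gs; have := smooth_realZ (-1) gs.
by congr smooth_real; apply/funext => p; rewrite mulN1r.
Qed.

(** The mean value theorem is used twice, on the increment of G in its second argument and then on
    [G1 s]. The second difference is symmetric in the two variables, so expanding it in the other
    order compares the mixed derivatives. *)
Lemma mixed_mean_value (G G1 G12 : R -> R -> R) (x y t : R) : 0 < t ->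
  (forall s u : R, is_derive s 1 (G^~ u) (G1 s u)) ->
  (forall s u : R, is_derive u 1 (G1 s) (G12 s u)) ->
  exists s u, [/\ x < s < x + t, y < u < y + t &
    G (x + t) (y + t) - G (x + t) y - (G x (y + t) - G x y) =
    G12 s u * (t * t)].
Proof.
move=> t0 dG dG1.
have xt : x < x + t by rewrite ltrDl.
have yt : y < y + t by rewrite ltrDl.
have dGt (s : R) : is_derive s 1 (fun s => G s (y + t) - G s y)
    (G1 s (y + t) - G1 s y) by apply: is_deriveB; exact: dG.
have [s sI Es] := MVT xt (fun s _ => dGt s)
  (derivable_within_continuous (fun s _ => @ex_derive _ _ _ _ _ _ _ (dGt s))).
have [u uI Eu] := MVT yt (fun u _ => dG1 s u)
  (derivable_within_continuous (fun u _ => @ex_derive _ _ _ _ _ _ _ (dG1 s u))).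
exists s, u; split; [by rewrite in_itv in sI|by rewrite in_itv in uI|].
by rewrite Es Eu; ring.
Qed.

Lemma near_corner (x y m d s u : R) : m <= d ->
  x < s < x + m / 2 -> y < u < y + m / 2 -> ball (x, y) d (s, u).
Proof.
move=> md /andP[xs sx] /andP[yu uy]; split; rewrite /ball /= distrC ger0_norm;
  lra.
Qed.

Lemma dist_le_halves (a b c d e : R) :
  `|a - b| < e / 2 -> `|c - d| < e / 2 -> d = b -> `|a - c| <= e.
Proof.
move=> ab cd db; rewrite -(subrKA b) (le_trans (ler_normD _ _))//.
by rewrite [X in _ <= X]splitr lerD ?ltW// distrC -db.
Qed.

Lemma subrACA (a b c d : R) : a - b - (c - d) = a - c - (b - d).
Proof. by ring. Qed.

(* Both sides are the limit, as t tends to 0, of the second difference of g on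
   a square of side t at p, divided by t^2. *)
Lemma smooth_real_clairaut g : smooth_real g ->
  'D_(axis R false) ('D_(axis R true) g) = 'D_(axis R true) ('D_(axis R false) g).
Proof.
move=> gs; suff key (x y : R) : 'D_(axis R false) ('D_(axis R true) g) (x, y) =
    'D_(axis R true) ('D_(axis R false) g) (x, y).
  by apply/funext => -[x y]; exact: key.
have dslice b h p : smooth_real h ->
    is_derive (pcoord b p) 1 (h \o slice b p) ('D_(axis R b) h p).
  by move=> hs; apply/is_derive_sliceP/derivableP; exact: smooth_real_derivable.
have ders b : smooth_real ('D_(axis R b) g) by exact: smooth_real_derive.
pose K b := 'D_(axis R (~~ b)) ('D_(axis R b) g).
have Kc b : continuous (K b).
  by apply: smooth_real_continuous; exact: smooth_real_derive.
rewrite -[LHS]/(K true (x, y)) -[RHS]/(K false (x, y)).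
apply/eqP; rewrite -subr_eq0 -normr_le0; apply/ler_addgt0Pr => e e0.
have e20 : 0 < e / 2 by rewrite divr_gt0.
have near_K b : \forall q \near (x, y), `|K b (x, y) - K b q| < e / 2.
  by have /cvgr_dist_lt /(_ _ e20) := Kc b (x, y).
have /nbhs_ballP [d1 /= d10 K1] := near_K true.
have /nbhs_ballP [d2 /= d20 K2] := near_K false.
pose t := Num.min d1 d2 / 2.
have m0 : 0 < Num.min d1 d2 by rewrite lt_min; apply/andP; split.
have t0 : 0 < t by rewrite divr_gt0.
have [s1 [u1 [s1I u1I E1]]] := @mixed_mean_value (fun s u => g (s, u))
  (fun s u => 'D_(axis R false) g (s, u)) (fun s u => K false (s, u)) x y t t0
  (fun s u => dslice false _ (s, u) gs) (fun s u => dslice true _ (s, u) (ders false)).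
have [u2 [s2 [u2I s2I E2]]] := @mixed_mean_value (fun u s => g (s, u))
  (fun u s => 'D_(axis R true) g (s, u)) (fun u s => K true (s, u)) y x t t0
  (fun u s => dslice true _ (s, u) gs) (fun u s => dslice false _ (s, u) (ders true)).
have KE : K false (s1, u1) = K true (s2, u2).
  have tt0 : t * t != 0 by rewrite mulf_neq0 ?gt_eqF.
  by apply: (mulIf tt0); apply: etrans (esym E1) (etrans (subrACA _ _ _ _) E2).
have [m1 m2] : Num.min d1 d2 <= d1 /\ Num.min d1 d2 <= d2.
  by split; rewrite ge_min lexx ?orbT.
have A1 := K1 (s2, u2) (near_corner m1 s2I u2I).
have A2 := K2 (s1, u1) (near_corner m2 s1I u1I).
rewrite add0r; exact: dist_le_halves A1 A2 KE.
Qed.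

End PartialDerivatives.

(** * Test functions and the ladder operators *)

Section TestFunctions.
Context {R : realType}.
Implicit Types (f g : R[i] -> R[i]) (z w a : R[i]) (p : R * R) (b : bool).

Lemma Re_mul z w : complex.Re (z * w) =
  complex.Re z * complex.Re w - complex.Im z * complex.Im w.
Proof. by case: z w => ? ? []. Qed.

Lemma Im_mul z w : complex.Im (z * w) =
  complex.Re z * complex.Im w + complex.Im z * complex.Re w.
Proof. by case: z w => ? ? []. Qed.

Lemma Re_add z w : complex.Re (z + w) = complex.Re z + complex.Re w.
Proof. by case: z w => ? ? []. Qed.

Lemma Im_add z w : complex.Im (z + w) = complex.Im z + complex.Im w.
Proof. by case: z w => ? ? []. Qed.

Lemma Re_opp z : complex.Re (- z) = - complex.Re z.
Proof. by case: z. Qed.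

Lemma Im_opp z : complex.Im (- z) = - complex.Im z.
Proof. by case: z. Qed.

Definition ReImE := (Re_mul, Im_mul, Re_add, Im_add, Re_opp, Im_opp).

Lemma invr2_complex : (2^-1 : R[i]) = (2^-1 : R)%:C.
Proof. by rewrite fmorphV /= rmorphD rmorph1. Qed.

Lemma cplx_ReIm z : cplx (complex.Re z, complex.Im z) = z.
Proof. by case: z. Qed.

Lemma eq_re_im f g :
  (forall p, re_part f p = re_part g p) ->
  (forall p, im_part f p = im_part g p) -> f = g.
Proof.
move=> fg_re fg_im; apply/funext => z; rewrite -(cplx_ReIm z).
set p := (_, _); have := fg_re p; have := fg_im p.
by rewrite /re_part /im_part; case: (f _) (g _) => ? ? [? ?] /= -> ->.
Qed.

Definition dz f z : R[i] :=
  2^-1 * (partial false f z - (0 +i* 1) * partial true f z).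

(** [raising] and [lowering] are the creation and annihilation operators of a harmonic oscillator,
    mutually adjoint for the weight exp |z|^2. *)
Definition raising f z : R[i] := - dbar f z.

Definition lowering f z : R[i] := dz f z + conjc z * f z.

Lemma re_raising f p : re_part (raising f) p =
  - 2^-1 * ('D_(axis R false) (re_part f) p - 'D_(axis R true) (im_part f) p).
Proof.
case: p => x y; rewrite /re_part /raising /dbar invr2_complex !ReImE /=.
by rewrite !mul0r !mul1r; ring.
Qed.

Lemma im_raising f p : im_part (raising f) p =
  - 2^-1 * ('D_(axis R false) (im_part f) p + 'D_(axis R true) (re_part f) p).
Proof.
case: p => x y; rewrite /im_part /raising /dbar invr2_complex !ReImE /=.
by rewrite !mul0r !mul1r; ring.
Qed.

Lemma re_lowering f p : re_part (lowering f) p =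
  2^-1 * ('D_(axis R false) (re_part f) p + 'D_(axis R true) (im_part f) p) +
  (pcoord false p * re_part f p + pcoord true p * im_part f p).
Proof.
case: p => x y; rewrite /re_part /lowering /dz invr2_complex !ReImE /=.
by rewrite !mul0r !mul1r /pcoord /=; ring.
Qed.

Lemma im_lowering f p : im_part (lowering f) p =
  2^-1 * ('D_(axis R false) (im_part f) p - 'D_(axis R true) (re_part f) p) +
  (pcoord false p * im_part f p - pcoord true p * re_part f p).
Proof.
case: p => x y; rewrite /im_part /lowering /dz invr2_complex !ReImE /=.
by rewrite !mul0r !mul1r /pcoord /=; ring.
Qed.

(** Vanishing outside a ball of the max norm passes to derivatives and linear combinations with an
    explicit radius, with no closure to carry along. *)
Definition bounded_support f := exists M : R, forall p, M < `|p| -> f (cplx p) = 0.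

Lemma compactly_supportedP f : compactly_supported f <-> bounded_support f.
Proof.
rewrite /compactly_supported; set S := [set p | _]; split=> [/compact_bounded[M [_ SM]]|[M fM]].
  exists (M + 1) => p Mp; apply: contrapT => fp0.
  have := SM (M + 1); rewrite ltrDl ltr01 => /(_ isT p (subset_closure fp0)) /=.
  by rewrite leNgt Mp.
pose box := `[- M, M]%classic `*` `[- M, M]%classic : set (R * R).
have cbox : compact box by apply: compact_setX; exact: segment_compact.
apply: (subclosed_compact _ cbox); first exact: closed_closure.
have /closure_id -> : closed box by apply: compact_closed => //; exact: norm_hausdorff.
apply: closureS => p /= fp0; have : `|p| <= M.
  by rewrite leNgt; apply/negP => /fM.
rewrite prod_normE ge_max => /andP[p1 p2].
by split; rewrite /= in_itv /= -ler_norml.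
Qed.

Definition test_function f := smooth f /\ bounded_support f.

(** The strict inequality is an open condition, so g vanishes in a neighbourhood of p and has there
    the derivative of a constant. *)
Lemma derive_bounded_support (g : R * R -> R) (M : R) b :
  (forall p, M < `|p| -> g p = 0) ->
  forall p, M < `|p| -> 'D_(axis R b) g p = 0.
Proof.
move=> gM p Mp; rewrite -(derive_cst 0 p (axis R b)); apply: near_eq_derive.
have /cvgr_gt/(_ _ Mp) := @norm_continuous _ _ p.
by apply: filterS => q /gM.
Qed.

Lemma bounded_supportP f : bounded_support f <->
  exists M : R, forall p, M < `|p| -> re_part f p = 0 /\ im_part f p = 0.
Proof.
split=> -[M fM]; exists M => p /fM; first by rewrite /re_part /im_part => ->.
by rewrite /re_part /im_part; case: (f _) => ? ? /= [-> ->].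
Qed.

Lemma test_raising f : test_function f -> test_function (raising f).
Proof.
move=> [[ref imf] /bounded_supportP[M fM]]; split.
  split.
    rewrite (funext (re_raising f)); apply: smooth_realZ; apply: smooth_realD.
      exact: smooth_real_derive.
    by apply: smooth_realN; exact: smooth_real_derive.
  rewrite (funext (im_raising f)); apply: smooth_realZ; apply: smooth_realD;
    exact: smooth_real_derive.
apply/bounded_supportP; exists M => p Mp.
have Dre b : 'D_(axis R b) (re_part f) p = 0.
  by apply: derive_bounded_support Mp => q /fM[].
have Dim b : 'D_(axis R b) (im_part f) p = 0.
  by apply: derive_bounded_support Mp => q /fM[].
by rewrite re_raising im_raising !Dre !Dim subr0 addr0 mulr0.
Qed.

Lemma test_lowering f : test_function f -> test_function (lowering f).
Proof.
move=> [[ref imf] /bounded_supportP[M fM]]; split.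
  split.
    rewrite (funext (re_lowering f)); apply: smooth_realD.
      apply: smooth_realZ; apply: smooth_realD; exact: smooth_real_derive.
    by apply: smooth_realD;
      [apply: smooth_realM (smooth_real_pcoord _) ref
      |apply: smooth_realM (smooth_real_pcoord _) imf].
  rewrite (funext (im_lowering f)); apply: smooth_realD.
    apply: smooth_realZ; apply: smooth_realD; first exact: smooth_real_derive.
    by apply: smooth_realN; exact: smooth_real_derive.
  apply: smooth_realD; first exact: smooth_realM (smooth_real_pcoord _) imf.
  by apply: smooth_realN; exact: smooth_realM (smooth_real_pcoord _) ref.
apply/bounded_supportP; exists M => p Mp.
have Dre b : 'D_(axis R b) (re_part f) p = 0.
  by apply: derive_bounded_support Mp => q /fM[].
have Dim b : 'D_(axis R b) (im_part f) p = 0.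
  by apply: derive_bounded_support Mp => q /fM[].
have [re0 im0] := fM p Mp.
by rewrite re_lowering im_lowering !Dre !Dim re0 im0 !(mulr0, addr0, subr0).
Qed.

Lemma test_lin a f g : test_function f -> test_function g ->
  test_function (a *: f + g).
Proof.
move=> [[ref imf] [M fM]] [[reg img] [N gN]]; split; last first.
  exists (Num.max M N) => p; rewrite gt_max => /andP[/fM fp /gN gp].
  by rewrite -[LHS]/(a * f (cplx p) + g (cplx p)) fp gp mulr0 addr0.
split.
  have -> : re_part (a *: f + g) = fun p => (complex.Re a * re_part f p +
      - (complex.Im a * im_part f p)) + re_part g p.
    by apply/funext => p; rewrite /re_part /= !ReImE.
  apply: smooth_realD reg; apply: smooth_realD (smooth_realZ _ ref) _.
  exact: smooth_realN (smooth_realZ _ imf).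
have -> : im_part (a *: f + g) = fun p => (complex.Re a * im_part f p +
    complex.Im a * re_part f p) + im_part g p.
  by apply/funext => p; rewrite /im_part /= !ReImE.
by apply: smooth_realD img; exact: smooth_realD (smooth_realZ _ imf) (smooth_realZ _ ref).
Qed.

End TestFunctions.

(** * The canonical commutation relation of the ladder operators *)

Section Commutation.
Context {R : realType}.
Implicit Types (f g : R[i] -> R[i]) (z w a : R[i]) (p : R * R) (b : bool).
Implicit Types (u v : R * R -> R).

Lemma derive_smooth_lin b (r s : R) u v p : smooth_real u -> smooth_real v ->
  'D_(axis R b) (fun q => r * u q + s * v q) p =
  r * 'D_(axis R b) u p + s * 'D_(axis R b) v p.
Proof.
move=> us vs; have ud : derivable u p (axis R b) := smooth_real_derivable us.
have vd : derivable v p (axis R b) := smooth_real_derivable vs.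
have H := is_deriveD (is_deriveZ r (derivableP ud)) (is_deriveZ s (derivableP vd)).
exact: (@derive_val _ _ _ _ _ _ _ H).
Qed.

Lemma derive_smooth_pcoordM b c u p : smooth_real u ->
  'D_(axis R b) (fun q => pcoord c q * u q) p =
  (if b == c then 1 else 0) * u p + pcoord c p * 'D_(axis R b) u p.
Proof.
move=> us; have ud : derivable u p (axis R b) := smooth_real_derivable us.
have H := is_deriveM (is_derive_pcoord b c p) (derivableP ud).
by rewrite (@derive_val _ _ _ _ _ _ _ H) addrC; congr (_ + _); exact: mulrC.
Qed.

Lemma test_re f : test_function f -> smooth_real (re_part f).
Proof. by case=> -[]. Qed.

Lemma test_im f : test_function f -> smooth_real (im_part f).
Proof. by case=> -[]. Qed.

(** The factors [1 *] give each nested sum the shape r u + s v, to which linearity of derivatives,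
    and later of twists and integrals, applies by rewriting. *)
Lemma re_lin a f g : re_part (a *: f + g) =
  fun p => 1 * (complex.Re a * re_part f p + - complex.Im a * im_part f p) + 1 * re_part g p.
Proof. by apply/funext => p; rewrite /re_part /= !ReImE; ring. Qed.

Lemma im_lin a f g : im_part (a *: f + g) =
  fun p => 1 * (complex.Re a * im_part f p + complex.Im a * re_part f p) + 1 * im_part g p.
Proof. by apply/funext => p; rewrite /im_part /= !ReImE; ring. Qed.

Lemma smooth_real_lin (r s : R) u v : smooth_real u -> smooth_real v ->
  smooth_real (fun q => r * u q + s * v q).
Proof. by move=> us vs; exact: smooth_realD (smooth_realZ _ us) (smooth_realZ _ vs). Qed.

Lemma derive_re_lin a f g b p : test_function f -> test_function g ->
  'D_(axis R b) (re_part (a *: f + g)) p =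
  complex.Re a * 'D_(axis R b) (re_part f) p
  - complex.Im a * 'D_(axis R b) (im_part f) p + 'D_(axis R b) (re_part g) p.
Proof.
move=> tf tg; have [rf imf] := (test_re tf, test_im tf).
rewrite re_lin (derive_smooth_lin _ _ _ _ (smooth_real_lin _ _ rf imf) (test_re tg)).
by rewrite (derive_smooth_lin _ _ _ _ rf imf) !mul1r ?mulNr.
Qed.

Lemma derive_im_lin a f g b p : test_function f -> test_function g ->
  'D_(axis R b) (im_part (a *: f + g)) p =
  complex.Re a * 'D_(axis R b) (im_part f) p
  + complex.Im a * 'D_(axis R b) (re_part f) p + 'D_(axis R b) (im_part g) p.
Proof.
move=> tf tg; have [rf imf] := (test_re tf, test_im tf).
rewrite im_lin (derive_smooth_lin _ _ _ _ (smooth_real_lin _ _ imf rf) (test_im tg)).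
by rewrite (derive_smooth_lin _ _ _ _ imf rf) !mul1r ?mulNr.
Qed.

Lemma raising_lin a f g : test_function f -> test_function g ->
  raising (a *: f + g) = a *: raising f + raising g.
Proof.
move=> tf tg; apply: eq_re_im => p.
- rewrite re_lin re_raising !(derive_re_lin _ _ _ tf tg) !(derive_im_lin _ _ _ tf tg).
  rewrite (re_raising f) (im_raising f) (re_raising g).
  move: ('D_(axis R false) (re_part f) p) ('D_(axis R true) (re_part f) p)
    ('D_(axis R false) (im_part f) p) ('D_(axis R true) (im_part f) p)
    ('D_(axis R false) (re_part g) p) ('D_(axis R true) (re_part g) p)
    ('D_(axis R false) (im_part g) p) ('D_(axis R true) (im_part g) p).
  by move=> d1 d2 d3 d4 d5 d6 d7 d8; ring.
- rewrite im_lin im_raising !(derive_re_lin _ _ _ tf tg) !(derive_im_lin _ _ _ tf tg).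
  rewrite (re_raising f) (im_raising f) (im_raising g).
  move: ('D_(axis R false) (re_part f) p) ('D_(axis R true) (re_part f) p)
    ('D_(axis R false) (im_part f) p) ('D_(axis R true) (im_part f) p)
    ('D_(axis R false) (re_part g) p) ('D_(axis R true) (re_part g) p)
    ('D_(axis R false) (im_part g) p) ('D_(axis R true) (im_part g) p).
  by move=> d1 d2 d3 d4 d5 d6 d7 d8; ring.
Qed.

Lemma lowering_lin a f g : test_function f -> test_function g ->
  lowering (a *: f + g) = a *: lowering f + lowering g.
Proof.
move=> tf tg; apply: eq_re_im => p.
- rewrite re_lin re_lowering !(derive_re_lin _ _ _ tf tg) !(derive_im_lin _ _ _ tf tg) re_lin im_lin.
  rewrite (re_lowering f) (im_lowering f) (re_lowering g).
  move: ('D_(axis R false) (re_part f) p) ('D_(axis R true) (re_part f) p)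
    ('D_(axis R false) (im_part f) p) ('D_(axis R true) (im_part f) p)
    ('D_(axis R false) (re_part g) p) ('D_(axis R true) (re_part g) p)
    ('D_(axis R false) (im_part g) p) ('D_(axis R true) (im_part g) p).
  by move=> d1 d2 d3 d4 d5 d6 d7 d8; ring.
- rewrite im_lin im_lowering !(derive_re_lin _ _ _ tf tg) !(derive_im_lin _ _ _ tf tg) re_lin im_lin.
  rewrite (re_lowering f) (im_lowering f) (im_lowering g).
  move: ('D_(axis R false) (re_part f) p) ('D_(axis R true) (re_part f) p)
    ('D_(axis R false) (im_part f) p) ('D_(axis R true) (im_part f) p)
    ('D_(axis R false) (re_part g) p) ('D_(axis R true) (re_part g) p)
    ('D_(axis R false) (im_part g) p) ('D_(axis R true) (im_part g) p).
  by move=> d1 d2 d3 d4 d5 d6 d7 d8; ring.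
Qed.

Lemma raisingE f : re_part (raising f) = (fun p =>
    - 2^-1 * 'D_(axis R false) (re_part f) p + 2^-1 * 'D_(axis R true) (im_part f) p) /\
  im_part (raising f) = (fun p =>
    - 2^-1 * 'D_(axis R false) (im_part f) p + - 2^-1 * 'D_(axis R true) (re_part f) p).
Proof. by split; apply/funext => p; rewrite ?re_raising ?im_raising; ring. Qed.

Lemma loweringE f : re_part (lowering f) = (fun p =>
    1 * (2^-1 * 'D_(axis R false) (re_part f) p + 2^-1 * 'D_(axis R true) (im_part f) p)
  + 1 * (1 * (pcoord false p * re_part f p) + 1 * (pcoord true p * im_part f p))) /\
  im_part (lowering f) = (fun p =>
    1 * (2^-1 * 'D_(axis R false) (im_part f) p + - 2^-1 * 'D_(axis R true) (re_part f) p)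
  + 1 * (1 * (pcoord false p * im_part f p) + - 1 * (pcoord true p * re_part f p))).
Proof. by split; apply/funext => p; rewrite ?re_lowering ?im_lowering; ring. Qed.

Lemma re_add f g p : re_part (f + g) p = re_part f p + re_part g p.
Proof. exact: Re_add. Qed.

Lemma im_add f g p : im_part (f + g) p = im_part f p + im_part g p.
Proof. exact: Im_add. Qed.

(** Clairaut cancels the second-order terms; what is left of [d/dz + conj z, - dbar] is dbar (conj
    z) = 1. *)
Lemma lowering_raising f : test_function f ->
  lowering (raising f) = raising (lowering f) + f.
Proof.
move=> tf; have [rf imf] := (test_re tf, test_im tf).
have drf b : smooth_real ('D_(axis R b) (re_part f)) by exact: smooth_real_derive.
have dif b : smooth_real ('D_(axis R b) (im_part f)) by exact: smooth_real_derive.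
have prf b := smooth_realM (@smooth_real_pcoord R b) rf.
have pif b := smooth_realM (@smooth_real_pcoord R b) imf.
have slin := smooth_real_lin.
have [rrE irE] := raisingE f; have [rlE ilE] := loweringE f.
have Cr p := congr1 (fun h => h p) (smooth_real_clairaut rf).
have Ci p := congr1 (fun h => h p) (smooth_real_clairaut imf).
have Drr b p : 'D_(axis R b) (re_part (raising f)) p =
    - 2^-1 * 'D_(axis R b) ('D_(axis R false) (re_part f)) p +
    2^-1 * 'D_(axis R b) ('D_(axis R true) (im_part f)) p.
  by rewrite rrE; exact: (derive_smooth_lin _ _ _ _ (drf _) (dif _)).
have Dir b p : 'D_(axis R b) (im_part (raising f)) p =
    - 2^-1 * 'D_(axis R b) ('D_(axis R false) (im_part f)) p +
    - 2^-1 * 'D_(axis R b) ('D_(axis R true) (re_part f)) p.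
  by rewrite irE; exact: (derive_smooth_lin _ _ _ _ (dif _) (drf _)).
have Drl b p : 'D_(axis R b) (re_part (lowering f)) p =
    2^-1 * 'D_(axis R b) ('D_(axis R false) (re_part f)) p +
    2^-1 * 'D_(axis R b) ('D_(axis R true) (im_part f)) p +
    ((if b == false then 1 else 0) * re_part f p +
      pcoord false p * 'D_(axis R b) (re_part f) p +
    ((if b == true then 1 else 0) * im_part f p +
      pcoord true p * 'D_(axis R b) (im_part f) p)).
  rewrite rlE (derive_smooth_lin _ _ _ _ (slin _ _ _ _ (drf _) (dif _))
    (slin _ _ _ _ (prf _) (pif _))).
  rewrite (derive_smooth_lin _ _ _ _ (drf _) (dif _)).
  rewrite (derive_smooth_lin _ _ _ _ (prf _) (pif _)).
  by rewrite (derive_smooth_pcoordM _ _ _ rf) (derive_smooth_pcoordM _ _ _ imf) !mul1r.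
have Dil b p : 'D_(axis R b) (im_part (lowering f)) p =
    2^-1 * 'D_(axis R b) ('D_(axis R false) (im_part f)) p +
    - 2^-1 * 'D_(axis R b) ('D_(axis R true) (re_part f)) p +
    ((if b == false then 1 else 0) * im_part f p +
      pcoord false p * 'D_(axis R b) (im_part f) p -
    ((if b == true then 1 else 0) * re_part f p +
      pcoord true p * 'D_(axis R b) (re_part f) p)).
  rewrite ilE (derive_smooth_lin _ _ _ _ (slin _ _ _ _ (dif _) (drf _))
    (slin _ _ _ _ (pif _) (prf _))).
  rewrite (derive_smooth_lin _ _ _ _ (dif _) (drf _)).
  rewrite (derive_smooth_lin _ _ _ _ (pif _) (prf _)).
  rewrite (derive_smooth_pcoordM _ _ _ rf) (derive_smooth_pcoordM _ _ _ imf).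
  by rewrite !mul1r mulN1r.
(* The summand f arises as two halves, one from d/dx and one from d/dy acting on conj z. *)
have half : (2^-1 + 2^-1 : R) = 1 by rewrite [RHS]splitr mul1r.
apply: eq_re_im => p.
- rewrite re_add re_raising re_lowering Drr Dir Drl Dil Ci rrE irE /=.
  set A := 'D_(axis R false) ('D_(axis R false) (re_part f)) p.
  set B := 'D_(axis R true) ('D_(axis R true) (re_part f)) p.
  set C := 'D_(axis R true) ('D_(axis R false) (im_part f)) p.
  set X := 'D_(axis R false) (re_part f) p; set Y := 'D_(axis R true) (re_part f) p.
  set Z := 'D_(axis R false) (im_part f) p; set W := 'D_(axis R true) (im_part f) p.
  move: A B C X Y Z W (re_part f p) (im_part f p) => A B C X Y Z W u v.
  move: (pcoord false p) (pcoord true p) => x y.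
  by rewrite !mul1r !mul0r [X in _ = _ + X](_ : u = (2^-1 + 2^-1) * u) ; [ring|rewrite half mul1r].
- rewrite im_add im_raising im_lowering Drr Dir Drl Dil Cr rrE irE /=.
  set A := 'D_(axis R false) ('D_(axis R false) (im_part f)) p.
  set B := 'D_(axis R true) ('D_(axis R true) (im_part f)) p.
  set C := 'D_(axis R true) ('D_(axis R false) (re_part f)) p.
  set X := 'D_(axis R false) (re_part f) p; set Y := 'D_(axis R true) (re_part f) p.
  set Z := 'D_(axis R false) (im_part f) p; set W := 'D_(axis R true) (im_part f) p.
  move: A B C X Y Z W (re_part f p) (im_part f p) => A B C X Y Z W u v.
  move: (pcoord false p) (pcoord true p) => x y.
  by rewrite !mul1r !mul0r [X in _ = _ + X](_ : v = (2^-1 + 2^-1) * v) ; [ring|rewrite half mul1r].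
Qed.

End Commutation.

(** * Integration by parts on the plane *)

Section PlaneMeasure.
Context {R : realType}.
Implicit Types (g : R * R -> R) (p : R * R) (b : bool).

(** The sigma-algebra of the plane is that of a product, so an open set is written as a countable
    union of the rational open boxes it contains. [F] enumerates the boxes, with the empty set at
    indices that decode to none or to one not inside U. *)
Lemma open_measurable_plane (U : set (R * R)) :
  open U -> measurable (U : set (plane R)).
Proof.
move=> oU.
pose rbox (q : rat * rat * (rat * rat)) : set (R * R) :=
  `]ratr q.1.1, ratr q.1.2[%classic `*` `]ratr q.2.1, ratr q.2.2[%classic.
pose F n : set (plane R) := if @unpickle (rat * rat * (rat * rat))%type n is Some q then
   (if `[< rbox q `<=` U >] then rbox q else set0) else set0.
suff -> : U = \bigcup_n F n.
  apply: bigcupT_measurable => n; rewrite /F; case: unpickle => // q.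
  by case: ifP => // _; apply: measurableX; exact: measurable_itv.
apply/seteqP; split=> [[x y] Uxy|p [n _]]; last first.
  by rewrite /F; case: unpickle => // q; case: asboolP => // qU /qU.
have /nbhs_ballP[e /= e0 eU] : nbhs (x, y) U by exact: open_nbhs_nbhs.
have [a1 /[!in_itv]/= /andP[xa1 a1x]] := @rat_in_itvoo R (x - e) x ltac:(by rewrite gtrBl).
have [a2 /[!in_itv]/= /andP[xa2 a2x]] := @rat_in_itvoo R x (x + e) ltac:(by rewrite ltrDl).
have [b1 /[!in_itv]/= /andP[yb1 b1y]] := @rat_in_itvoo R (y - e) y ltac:(by rewrite gtrBl).
have [b2 /[!in_itv]/= /andP[yb2 b2y]] := @rat_in_itvoo R y (y + e) ltac:(by rewrite ltrDl).
have qU : rbox ((a1, a2), (b1, b2)) `<=` U.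
  move=> [s t] [/= /[!in_itv]/= /andP[s1 s2] /andP[t1 t2]]; apply: eU; split => /=;
    by rewrite /ball /= ltr_norml; apply/andP; split; lra.
pose q := ((a1, a2), (b1, b2)); exists (pickle q); first exact: I.
rewrite /F pickleK asboolT; last exact: qU.
by split; rewrite /= in_itv /=; apply/andP.
Qed.

Lemma compact_measurable_plane (K : set (R * R)) :
  compact K -> measurable (K : set (plane R)).
Proof.
move=> /(compact_closed (@norm_hausdorff _ _)) /closed_openC.
by move=> /open_measurable_plane/measurableC; rewrite setCK.
Qed.

Lemma continuous_measurable_plane g : continuous g ->
  measurable_fun [set: plane R] (g : plane R -> R).
Proof.
move=> /continuousP cg; apply: (measurability _ (measurable_realfun.RGenOpens.measurableE R)).
move=> _ [_ [a [b ->] <-]]; rewrite setTI; apply: open_measurable_plane.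
exact/cg/interval_open.
Qed.

Definition box (M : R) : set (R * R) := `[- M, M]%classic `*` `[- M, M]%classic.

Lemma in_box M p : box M p <-> `|p| <= M.
Proof.
rewrite prod_normE ge_max; split=> [[]|/andP[p1 p2]].
  by rewrite /= !in_itv /= -!ler_norml => -> ->.
by split; rewrite /= in_itv /= -ler_norml.
Qed.

Lemma compact_box M : compact (box M).
Proof. by apply: compact_setX; exact: segment_compact. Qed.

Lemma dsigma_box_lty M : (@dsigma R (box M : set (plane R)) < +oo)%E.
Proof.
have itv_lty : (@lebesgue_measure R `[(- M)%R, M]%classic < +oo)%E.
  by apply: compact_finite_measure; exact: segment_compact.
rewrite [X in (X < _)%E](_ : _ = (@lebesgue_measure R `[(- M)%R, M]%classic *
  @lebesgue_measure R `[(- M)%R, M]%classic)%E).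
  by rewrite lte_mul_pinfty ?measure_ge0 ?ge0_fin_numE.
by apply: product_measure1E; exact: measurable_itv.
Qed.

Lemma continuous_integrable g (M : R) : continuous g ->
  (forall p, M < `|p| -> g p = 0) ->
  (@dsigma R).-integrable setT (EFin \o (g : plane R -> R)).
Proof.
move=> cg gM; have mbox := compact_measurable_plane (compact_box (M := M)).
have -> : EFin \o (g : plane R -> R) =
    (EFin \o (g : plane R -> R)) \_ (box M : set (plane R)).
  apply/funext => p; rewrite patchE; case: ifPn => //= /negP pbox.
  congr EFin; apply: gM; rewrite ltNge; apply/negP => pM; apply: pbox.
  by rewrite inE; apply/in_box.
apply/(integrable_mkcond _ mbox).
apply: measurable_bounded_integrable => //.
- exact: dsigma_box_lty.
- by apply: measurable_funTS; exact: continuous_measurable_plane.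
have /compact_bounded : compact (g @` box M).
  apply: continuous_compact; last exact: compact_box.
  exact: continuous_subspaceT.
move=> [N [Nreal HN]]; exists N; split=> // x Nx p pbox.
by apply: HN Nx _ _; exists p.
Qed.

Lemma integral1_derive0 (G : R -> R) (M : R) : (forall t, derivable G t 1) ->
  continuous ('D_1 G) -> (forall t, M < `|t| -> G t = 0) ->
  (\int[lebesgue_measure]_t ('D_1 G t)%:E = 0)%E.
Proof.
(* N is positive and exceeds M: the interval is nondegenerate and G vanishes at both endpoints. *)
move=> dG cG GM; pose N := `|M| + 1.
have MN : M < N by rewrite (le_lt_trans (ler_norm _))// ltrDl.
have N0 : 0 < N by rewrite ltr_wpDl.
have DM t : M < `|t| -> 'D_1 G t = 0.
  move=> Mt; rewrite -(derive_cst 0 t (1 : R)); apply: near_eq_derive.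
  have /cvgr_gt/(_ _ Mt) := @norm_continuous _ _ t.
  by apply: filterS => q /GM.
have cGc : continuous G.
  by move=> t; apply: differentiable_continuous; apply/derivable1_diffP.
rewrite (_ : (fun t => _) = (fun t => ('D_1 G t)%:E) \_ `[- N, N]%classic); last first.
  apply/funext => t; rewrite patchE; case: ifPn => //= /negP tN.
  rewrite DM// (lt_trans MN)// ltNge; apply/negP => tN'; apply: tN.
  by rewrite inE /= in_itv /= -ler_norml.
rewrite -integral_mkcond (@continuous_FTC2 _ _ G).
- by rewrite !GM ?subee// ?normrN gtr0_norm.
- by rewrite gtrN.
- exact: continuous_subspaceT.
- by split=> //; apply: cvg_at_right_filter || apply: cvg_at_left_filter; exact: cGc.
- by move=> t _; rewrite derive1E.
Qed.

(** Fubini with the inner integral along the axis b, where each slice is the derivative of a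
    function of bounded support on the line. *)
Lemma integral_derive0 g (M : R) b : (forall p, derivable g p (axis R b)) ->
  continuous ('D_(axis R b) g) -> (forall p, M < `|p| -> g p = 0) ->
  (\int[@dsigma R]_p ('D_(axis R b) g p)%:E = 0)%E.
Proof.
move=> dg cg gM.
have ig := continuous_integrable cg (fun p => @derive_bounded_support R g M b gM p).
have slice0 p : (\int[lebesgue_measure]_t ('D_(axis R b) g (slice b p t))%:E = 0)%E.
  have Dslice t : 'D_1 (g \o slice b p) t = 'D_(axis R b) g (slice b p t).
    by rewrite derive_slice slice_slice pcoord_slice.
  under eq_integral do rewrite -Dslice.
  apply: (@integral1_derive0 _ M) => [t||t Mt].
  - by have := dg (slice b p t); rewrite derivable_slice slice_slice pcoord_slice.
  - rewrite (funext Dslice) => t.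
    exact: (continuous_comp (@continuous_slice R b p t) (cg (slice b p t))).
  - apply: (gM (slice b p t)); rewrite prod_normE lt_max.
    by case: (b); rewrite /slice /= Mt ?orbT.
case: b slice0 {dg cg} ig => slice0 ig.
- rewrite -(integral12_prod_meas1 ig) integral0_eq// => x _.
  exact: (slice0 (x, 0)).
- rewrite -(integral21_prod_meas1 ig) integral0_eq// => y _.
  exact: (slice0 (0, y)).
Qed.

End PlaneMeasure.

(** * Minimal solutions and the commutator estimate in an inner product space *)

Section InnerProduct.
Context {R : realType} {X : lmodType R[i]} (S : X -> Prop) (ip : X -> X -> R).
Context (S_lin : forall (a : R[i]) x y, S x -> S y -> S (a *: x + y)).
Context (ipC : forall x y, ip x y = ip y x).
Context (ip_lin : forall (t : R) x y z, S x -> S y -> S z ->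
  ip (t%:C *: x + y) z = t * ip x z + ip y z).
Context (ip_ge0 : forall x, 0 <= ip x x).
Implicit Types (x y z : X) (t : R).

Lemma ipDl x y z : S x -> S y -> S z -> ip (x + y) z = ip x z + ip y z.
Proof. by move=> Sx Sy Sz; have := ip_lin 1 Sx Sy Sz; rewrite scale1r mul1r. Qed.

Lemma ipDr x y z : S x -> S y -> S z -> ip z (x + y) = ip z x + ip z y.
Proof. by move=> Sx Sy Sz; rewrite ipC ipDl// !(ipC z). Qed.

Lemma dom0 x : S x -> S 0.
Proof. by move=> Sx; have := S_lin (-1) Sx Sx; rewrite scaleN1r addNr. Qed.

Lemma dom_scale (a : R[i]) x : S x -> S (a *: x).
Proof. by move=> Sx; have := S_lin a Sx (dom0 Sx); rewrite addr0. Qed.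

Lemma dom_add x y : S x -> S y -> S (x + y).
Proof. by move=> Sx Sy; have := S_lin 1 Sx Sy; rewrite scale1r. Qed.

Lemma dom_sub x y : S x -> S y -> S (x - y).
Proof. by move=> Sx Sy; rewrite addrC -scaleN1r; exact: S_lin. Qed.

Lemma ip0 x : S x -> ip 0 x = 0.
Proof.
move=> Sx; have := ipDl (dom0 Sx) (dom0 Sx) Sx; rewrite addr0 => /eqP.
by rewrite -subr_eq subrr eq_sym => /eqP.
Qed.

Lemma ipZl t x y : S x -> S y -> ip (t%:C *: x) y = t * ip x y.
Proof.
by move=> Sx Sy; have := ip_lin t Sx (dom0 Sx) Sy; rewrite addr0 ip0// addr0.
Qed.

Lemma ipZr t x y : S x -> S y -> ip x (t%:C *: y) = t * ip x y.
Proof. by move=> Sx Sy; rewrite ipC ipZl// ipC. Qed.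

Lemma ipBl x y z : S x -> S y -> S z -> ip (x - y) z = ip x z - ip y z.
Proof.
move=> Sx Sy Sz; rewrite ipDl//; last by rewrite -scaleN1r; exact: dom_scale.
by rewrite -scaleN1r -(rmorphN1 (real_complex R)) ipZl// mulN1r.
Qed.

Lemma ip_sqr_lin t x y : S x -> S y ->
  ip (t%:C *: x + y) (t%:C *: x + y) = t ^+ 2 * ip x x + 2 * t * ip x y + ip y y.
Proof.
move=> Sx Sy; have Stx := dom_scale t%:C Sx; rewrite ip_lin//; last exact: dom_add.
by rewrite !ipDr// !ipZr// (ipC y x); ring.
Qed.

Lemma ip_sqrB x y : S x -> S y ->
  ip (x - y) (x - y) = ip x x - 2 * ip x y + ip y y.
Proof.
move=> Sx Sy; have := ip_sqr_lin (-1) Sy Sx.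
by rewrite rmorphN1 scaleN1r addrC => ->; rewrite ipC; ring.
Qed.

(** The case c = 0 has to be covered because the inner products are only semidefinite. Besides
    Cauchy-Schwarz, this bounds the first variation at a near minimizer, where a is an optimality
    gap. *)
Lemma discriminant_le (a b c : R) : 0 <= c ->
  (forall t, 0 <= t ^+ 2 * c + 2 * t * b + a) -> b ^+ 2 <= c * a.
Proof.
rewrite le_eqVlt => /orP[/eqP <-|c0] q.
  rewrite mul0r; have [->|b0] := eqVneq b 0; first by rewrite expr0n.
  (* A nonconstant affine function with constant term a takes the value -1 at this point. *)
  have := q (- (a + 1) / (2 * b)); rewrite mulr0 add0r.
  have -> : 2 * (- (a + 1) / (2 * b)) * b + a = -1.
    by field; rewrite b0.
  by rewrite oppr_ge0 ler10.
have := q (- b / c); have -> : (- b / c) ^+ 2 * c + 2 * (- b / c) * b + a =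
    (c * a - b ^+ 2) / c by field; rewrite gt_eqF.
by rewrite pmulr_lge0 ?invr_gt0// subr_ge0.
Qed.

Lemma cauchy_schwarz x y : S x -> S y -> ip x y ^+ 2 <= ip x x * ip y y.
Proof.
move=> Sx Sy; apply: discriminant_le => // t.
by rewrite -ip_sqr_lin.
Qed.

Lemma sqr_add_le (a b c v e : R) : a ^+ 2 <= v * c -> b ^+ 2 <= c * e ->
  (a + b) ^+ 2 <= 2 * c * (v + e).
Proof. by move=> av be; have := sqr_ge0 (a - b); nra. Qed.

Lemma sqr_eq0_lim (c : R) (a : R) (v : nat -> R) :
  (forall n, c ^+ 2 <= a * v n) -> v n @[n --> \oo] --> 0 -> c = 0.
Proof.
move=> cv v0; apply/eqP; rewrite -sqrf_eq0 eq_le sqr_ge0 andbT.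
have av : a * v n @[n --> \oo] --> (0 : R).
  by rewrite -(mulr0 a); apply: cvgM v0; exact: cvg_cst.
rewrite -(cvg_lim (@Rhausdorff R) av); apply: limr_ge; first exact/cvgP/av.
exact: nearW.
Qed.

(** * Riesz representation by minimizing a quadratic functional *)

Section MinimalSolution.
Context (complete : forall u : nat -> X, (forall n, S (u n)) ->
  (forall n, ip (u n.+1 - u n) (u n.+1 - u n) <= (4 ^+ n)^-1) ->
  exists2 h, S h & ip (h - u n) (h - u n) @[n --> \oo] --> 0).
Context (P : X -> Prop) (A : X -> X) (ell : X -> R) (K : R).
Context (P0 : P 0) (P_lin : forall t x y, P x -> P y -> P (t%:C *: x + y)).
Context (AS : forall x, P x -> S (A x)).
Context (A_lin : forall t x y, P x -> P y ->
  A (t%:C *: x + y) = t%:C *: A x + A y).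
Context (ell_lin : forall t x y, P x -> P y ->
  ell (t%:C *: x + y) = t * ell x + ell y).
Context (K0 : 0 <= K) (ellK : forall x, P x -> ell x ^+ 2 <= K * ip (A x) (A x)).

(** If ell x = <h, A x>, then J x = |A x - h|^2 - |h|^2: minimizing J amounts to projecting the
    unknown h on the range of A. *)
Let J x := ip (A x) (A x) - 2 * ell x.

(** From ell^2 <= K N and 4 K N <= (K + N)^2. It bounds J below by - K, and at the end bounds the
    norm of the limit. *)
Let ell_le x : P x -> 2 * ell x <= K + ip (A x) (A x).
Proof.
move=> Px; have := ellK Px; have := ip_ge0 (A x).
move: (ell x) (ip _ _) => l N N0 lKN; rewrite leNgt; apply/negP => KNl.
have : (K + N) ^+ 2 < (2 * l) ^+ 2.
  by rewrite ltr_pXn2r// nnegrE ?addr_ge0// ltW// (le_lt_trans _ KNl)// addr_ge0.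
apply/negP; rewrite -leNgt; have := sqr_ge0 (K - N); nra.
Qed.

Let m := inf [set J x | x in P].

Let J_has_inf : has_inf [set J x | x in P].
Proof.
split; first by exists (J 0), 0.
by exists (- K) => _ [x Px <-]; have := ell_le Px; rewrite /J; lra.
Qed.

Let m_le x : P x -> m <= J x.
Proof. by move=> Px; apply: ge_inf; [exact: J_has_inf.2|exists x]. Qed.

Let J_step t x y : P x -> P y ->
  J (t%:C *: x + y) = t ^+ 2 * ip (A x) (A x) +
    2 * t * (ip (A x) (A y) - ell x) + J y.
Proof.
move=> Px Py; rewrite /J A_lin// ip_sqr_lin ?ell_lin//; [ring|exact: AS|exact: AS].
Qed.

(* Parallelogram identity, with the midpoint of x and y as a competitor. *)
Let near_minimizers x y : P x -> P y ->
  ip (A x - A y) (A x - A y) <= 2 * (J x - m) + 2 * (J y - m).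
Proof.
move=> Px Py.
have Pd : P ((-1)%:C *: y + x) by exact: P_lin.
have Ad : A ((-1)%:C *: y + x) = A x - A y.
  by rewrite A_lin// rmorphN1 scaleN1r addrC.
have := m_le (P_lin 2^-1 Pd Py).
have E : ip (A x - A y) (A y) = ip (A x) (A y) - ip (A y) (A y).
  by apply: ipBl; exact: AS.
rewrite J_step// Ad ell_lin// E.
have := ip_sqrB (AS Px) (AS Py).
have -> : J x = ip (A x) (A x) - 2 * ell x by [].
have -> : J y = ip (A y) (A y) - 2 * ell y by [].
move: (ip (A x - A y) _) (ip (A x) (A x)) (ip (A x) (A y)) (ip (A y) (A y)) (ell x) (ell y) m.
by move=> d a b e l1 l2 m0 ->; rewrite expr2; lra.
Qed.

(** The images under A of a minimizing sequence are Cauchy, and h is their limit. The last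
    conclusion expresses that h lies in the closure of the range: what is orthogonal to every
    [A (phi n)] is orthogonal to h. *)
Lemma minimal_solution : exists h, [/\ S h,
  forall x, P x -> ip h (A x) = ell x,
  ip h h <= K &
  forall w, S w -> (forall x, P x -> ip w (A x) = 0) -> ip h w = 0].
Proof.
(* With gaps 4^-(n+1), consecutive images are at squared distance at most 2/4^(n+2) + 2/4^(n+1) =
   (5/8)/4^n, within the rate asked by [complete]. *)
have e0 n : 0 < (4 ^+ n.+1 : R)^-1 by rewrite invr_gt0 exprn_gt0.
have /choice[phi phiP] n : exists x, P x /\ J x < m + (4 ^+ n.+1)^-1.
  have [_ [x Px <-] Jx] := inf_adherent (e0 n) J_has_inf.
  by exists x.
have Pphi n : P (phi n) by have [] := phiP n.
have Jphi n : J (phi n) - m <= (4 ^+ n.+1)^-1.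
  by have [_ Jn] := phiP n; rewrite lerBlDl ltW.
have Sphi n : S (A (phi n)) by exact: AS.
have [n|h Sh hphi] := complete Sphi.
  apply: le_trans (near_minimizers (Pphi _) (Pphi _)) _.
  have := Jphi n; have := Jphi n.+1.
  have -> : (4 ^+ n.+2)^-1 = (4 ^+ n)^-1 / 16 :> R.
    by rewrite !exprS !invfM; field; rewrite expf_neq0.
  have -> : (4 ^+ n.+1)^-1 = (4 ^+ n)^-1 / 4 :> R.
    by rewrite !exprS !invfM; field; rewrite expf_neq0.
  have : 0 <= (4 ^+ n : R)^-1 by rewrite invr_ge0 exprn_ge0.
  lra.
have solves x : P x -> ip h (A x) = ell x.
  move=> Px; apply/eqP; rewrite -subr_eq0; apply/eqP.
  have Sx := AS Px.
  apply: (@sqr_eq0_lim _ (2 * ip (A x) (A x))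
    (fun n => ip (h - A (phi n)) (h - A (phi n)) + (4 ^+ n.+1)^-1)).
    move=> n.
    have h1 : ip (h - A (phi n)) (A x) ^+ 2 <=
        ip (h - A (phi n)) (h - A (phi n)) * ip (A x) (A x).
      by apply: cauchy_schwarz => //; exact: dom_sub.
    (* First variation: J stays above its infimum on the line through [phi n] in direction x, and
       [J (phi n)] exceeds the infimum by at most the gap. *)
    have h2 : (ip (A x) (A (phi n)) - ell x) ^+ 2 <= ip (A x) (A x) * (4 ^+ n.+1)^-1.
      apply: discriminant_le => // t.
      have := m_le (P_lin t Px (Pphi n)); rewrite J_step//.
      by have := Jphi n; lra.
    have -> : ip h (A x) - ell x =
        ip (h - A (phi n)) (A x) + (ip (A x) (A (phi n)) - ell x).
      by rewrite ipBl// (ipC (A x)) addrA subrK.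
    exact: sqr_add_le.
  rewrite -[X in _ --> X]addr0; apply: cvgD => //.
  have := @cvg_geometric R 4^-1 4^-1; rewrite ger0_norm ?invr_ge0//.
  rewrite invf_lt1 ?ltr1n// => /(_ isT); apply: cvg_trans; apply: near_eq_cvg.
  by apply: nearW => n; rewrite /= exprS exprVn invfM.
exists h; split=> //.
  (* Since h represents ell, the left side equals [- J (phi n)]. *)
  have Nh n : ip h h - ip (h - A (phi n)) (h - A (phi n)) <= K.
    by rewrite (ip_sqrB Sh (Sphi n)) solves//; have := ell_le (Pphi n); lra.
  have lim_h : ip h h - ip (h - A (phi n)) (h - A (phi n)) @[n --> \oo] --> ip h h.
    by rewrite -[X in _ --> X]subr0; apply: cvgB => //; exact: cvg_cst.
  rewrite -(cvg_lim (@Rhausdorff R) lim_h); apply: limr_le; first exact/cvgP/lim_h.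
  exact: nearW.
move=> w Sw wA; apply: (@sqr_eq0_lim _ (ip w w) _ _ hphi) => n.
have -> : ip h w = ip (h - A (phi n)) w by rewrite ipBl// (ipC (A _)) wA// subr0.
by rewrite mulrC; apply: cauchy_schwarz => //; exact: dom_sub.
Qed.

End MinimalSolution.

(** * Norm estimates from the relation [L, D] = 1 *)

Section Commutation.
Context (P : X -> Prop) (D L : X -> X) (conj : R[i] -> R[i]).
Context (P_lin : forall a x y, P x -> P y -> P (a *: x + y)).
Context (PS : forall x, P x -> S x).
Context (DP : forall x, P x -> P (D x)) (LP : forall x, P x -> P (L x)).
Context (D_lin : forall a x y, P x -> P y -> D (a *: x + y) = a *: D x + D y).
Context (L_lin : forall a x y, P x -> P y -> L (a *: x + y) = a *: L x + L y).
Context (LD : forall x, P x -> L (D x) = D (L x) + x).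
Context (adj : forall x y, P x -> P y -> ip (L x) y = ip x (D y)).
Context (ip_conj : forall a x y, S x -> S y -> ip (a *: x) y = ip x (conj a *: y)).
Context (conjK : involutive conj).

Let itP (F : X -> X) n x : (forall x, P x -> P (F x)) -> P x -> P (iter n F x).
Proof. by move=> FP Px; elim: n => //= n; exact: FP. Qed.

Let it_lin (F : X -> X) n a x y : (forall x, P x -> P (F x)) ->
  (forall a x y, P x -> P y -> F (a *: x + y) = a *: F x + F y) ->
  P x -> P y -> iter n F (a *: x + y) = a *: iter n F x + iter n F y.
Proof.
by move=> FP F_lin Px Py; elim: n => //= n ->; rewrite F_lin//; exact: itP.
Qed.

Lemma iter_linear0 (F : X -> X) n a x : (forall x, P x -> P (F x)) ->
  (forall a x y, P x -> P y -> F (a *: x + y) = a *: F x + F y) ->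
  P x -> P 0 -> iter n F (a *: x) = a *: iter n F x.
Proof.
move=> FP F_lin Px Px0; have := it_lin n a FP F_lin Px Px0; rewrite addr0 => ->.
suff -> : iter n F 0 = 0 by rewrite addr0.
have := it_lin n (-1) FP F_lin Px0 Px0; rewrite scaler0 addr0 => {1}->.
by rewrite scaleN1r addNr.
Qed.

Let P0 x : P x -> P 0.
Proof. by move=> Px; have := P_lin (-1) Px Px; rewrite scaleN1r addNr. Qed.

Let comm_iter n x : P x ->
  L (iter n.+1 D x) = iter n.+1 D (L x) + (n.+1%:R : R)%:C *: iter n D x.
Proof.
move=> Px; elim: n => [|n IHn]; first by rewrite /= LD// scale1r.
have PD k : P (iter k D x) by exact: itP.
rewrite [iter n.+2 D x]iterS LD// IHn addrC [_ + (_ *: _)]addrC.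
rewrite D_lin//; last by apply: itP => //; exact: LP.
rewrite -!iterS addrA [RHS]addrC; congr (_ + _).
by rewrite -(natr1 n.+1) rmorphD scalerDl /= scale1r addrC.
Qed.

(** Gives the cross term of [norm_iterS] its sign. Moving one D across as L and commuting it inward
    adds a multiple of the same pairing one order lower, nonnegative by induction. *)
Let norm_comm n x : P x ->
  ip (iter n D (L x)) (iter n D (L x)) <= ip (iter n D x) (iter n.+1 D (L x)).
Proof.
move=> Px; have PLx := LP Px; elim: n => [|n IHn].
  by rewrite /= -adj.
have PD k z : P z -> P (iter k D z) by exact: itP.
rewrite [iter n.+2 D _]iterS -adj; [|exact: PD|exact: PD].
rewrite comm_iter// addrC ip_lin; [|exact/PS/PD..].
rewrite lerDr mulr_ge0//.
by rewrite (le_trans _ IHn).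
Qed.

Let norm_iterS n x : P x ->
  ip (iter n D (L x)) (iter n D (L x)) + n.+1%:R * ip (iter n D x) (iter n D x) <=
  ip (iter n.+1 D x) (iter n.+1 D x).
Proof.
move=> Px; have PD k z : P z -> P (iter k D z) by exact: itP.
have PLx := LP Px.
have -> : ip (iter n.+1 D x) (iter n.+1 D x) =
    ip (L (iter n.+1 D x)) (iter n D x) by rewrite [RHS]adj//; exact: PD.
rewrite comm_iter// [iter n.+1 D (L x) + _]addrC ip_lin; [|exact/PS/PD..].
by rewrite addrC lerD2l ipC norm_comm.
Qed.

(** The induction hypothesis at [L x] supplies the pure L term, the one at x the factorial, and the
    commutator in [norm_iterS] the new factor n + 2. The other terms are nonnegative and dropped. *)
Lemma norm_iter_ge n x : P x ->
  ip (iter n.+1 L x) (iter n.+1 L x) + (n.+1)`!%:R * ip x x <=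
  ip (iter n.+1 D x) (iter n.+1 D x).
Proof.
elim: n x => [|n IHn] x Px; first by have := norm_iterS 0 Px; rewrite /= mul1r.
apply: le_trans (norm_iterS n.+1 Px).
rewrite [iter n.+2 L x]iterSr factS natrM; apply: lerD.
  by apply: le_trans (IHn _ (LP Px)); rewrite lerDl mulr_ge0.
apply: le_trans (ler_wpM2l (ler0n R n.+2) (IHn _ Px)).
by rewrite mulrDr mulrA lerDr mulr_ge0.
Qed.

Let adj_iter n x y : P x -> P y -> ip (iter n L x) y = ip x (iter n D y).
Proof.
move=> Px Py; elim: n x Px => [//|n IHn] x Px.
by rewrite iterSr IHn ?adj//; [exact: itP|exact: LP].
Qed.

(** The exponent starts at one: at exponent zero the constant c could cancel b. *)
Lemma lower_bound n (b : R) c x : P x ->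
  b ^+ 2 * (n.+1)`!%:R * ip x x <=
  ip (b%:C *: iter n.+1 D x + c *: x) (b%:C *: iter n.+1 D x + c *: x).
Proof.
move=> Px; have PD k : P (iter k D x) by exact: itP.
have PLk k : P (iter k L x) by exact: itP.
have Sc a : S (a *: x) by apply: dom_scale; exact: PS.
have cross : ip (iter n.+1 D x) (c *: x) = ip (iter n.+1 L x) (conj c *: x).
  have Pcx : P (c *: x) by have := P_lin c Px (P0 Px); rewrite addr0.
  rewrite ipC -adj_iter// iter_linear0//; last exact: P0 Px.
  by rewrite ip_conj//; exact: PS.
have norms : ip (c *: x) (c *: x) = ip (conj c *: x) (conj c *: x).
  rewrite ip_conj//; last exact: PS.
  by rewrite [RHS]ip_conj ?conjK//; [rewrite !scalerA mulrC|exact: PS].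
(* The square of b L^(n+1) + conj c has the same cross term and the same |c|^2 term, so the two
   squares differ by b^2 (|D^(n+1) x|^2 - |L^(n+1) x|^2). *)
have := ip_ge0 (b%:C *: iter n.+1 L x + conj c *: x).
rewrite !ip_sqr_lin//; [|exact: PS..].
rewrite cross norms; have := norm_iter_ge n Px.
move/(ler_wpM2l (sqr_ge0 b)); rewrite mulrDr mulrA.
set u := b ^+ 2 * ip (iter n.+1 L x) _; set v := b ^+ 2 * ip (iter n.+1 D x) _.
set w := b ^+ 2 * _ * _; set r := 2 * b * _; set q := ip (conj c *: x) _.
by move: u v w r q => u v w r q; lra.
Qed.

End Commutation.
End InnerProduct.

(** * Completeness of L^2 *)

Lemma cvg_div_pow2 (R : realType) (C : R) : C / 2 ^+ n @[n --> \oo] --> 0.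
Proof.
rewrite -[X in _ --> X](mulr0 C); apply: cvgM; first exact: cvg_cst.
have := @cvg_expr R 2^-1; rewrite ger0_norm ?invr_ge0// invf_lt1 ?ltr1n// => /(_ isT).
by apply: cvg_trans; apply: near_eq_cvg; apply: nearW => n; rewrite /= exprVn.
Qed.

Section SquareIntegrable.
Context d (T : measurableType d) (R : realType) (mu : {measure set T -> \bar R}).
Implicit Types (u v w : T -> R) (a b : R).

Definition sqint u :=
  measurable_fun setT u /\ mu.-integrable setT (EFin \o (fun x => u x ^+ 2)).

Definition dot u v : R := \int[mu]_x (u x * v x).

Lemma sqint_mul u v : sqint u -> sqint v ->
  mu.-integrable setT (EFin \o (fun x => u x * v x)).
Proof.
move=> [mmu iu] [mv iv].
have iuv : mu.-integrable setT (EFin \o (fun x => u x ^+ 2 + v x ^+ 2)).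
  by have := integrableD measurableT iu iv; apply: eq_integrable.
apply: (le_integrable measurableT) iuv.
  by apply/measurable_EFinP; exact: measurable_funM.
move=> x _; rewrite /= lee_fin [X in _ <= X]ger0_norm ?addr_ge0 ?sqr_ge0//.
have := sqr_ge0 (u x + v x); have := sqr_ge0 (u x - v x).
have := sqr_ge0 (u x); have := sqr_ge0 (v x).
by move: (u x) (v x) => a b; rewrite ler_norml => ? ? ? ?; apply/andP; split; nra.
Qed.

Lemma sqint_lin a b u v : sqint u -> sqint v -> sqint (fun x => a * u x + b * v x).
Proof.
move=> su sv; have [[mmu iu] [mv iv]] := (su, sv); split.
  by apply: measurable_funD; apply: measurable_funM => //; exact: measurable_cst.
have iuv := sqint_mul su sv.
have := integrableD measurableT (integrableZl measurableT (a ^+ 2) iu)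
  (integrableD measurableT (integrableZl measurableT (2 * a * b) iuv)
    (integrableZl measurableT (b ^+ 2) iv)).
by apply: eq_integrable => // x _ /=; congr EFin; ring.
Qed.

Lemma dotC u v : dot u v = dot v u.
Proof. by apply: eq_Rintegral => x _; rewrite mulrC. Qed.

Lemma dot_ge0 u : 0 <= dot u u.
Proof. by apply: Rintegral_ge0 => x _; rewrite -expr2 sqr_ge0. Qed.

Lemma dot_lin a b u v w : sqint u -> sqint v -> sqint w ->
  dot (fun x => a * u x + b * v x) w = a * dot u w + b * dot v w.
Proof.
move=> su sv sw; have iu := sqint_mul su sw; have iv := sqint_mul sv sw.
rewrite /dot -!RintegralZl// -RintegralD//.
- by apply: eq_Rintegral => x _; ring.
- by have := integrableZl measurableT a iu; apply: eq_integrable.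
- by have := integrableZl measurableT b iv; apply: eq_integrable.
Qed.

Lemma dot_linr a b u v w : sqint u -> sqint v -> sqint w ->
  dot w (fun x => a * u x + b * v x) = a * dot w u + b * dot w v.
Proof. by move=> su sv sw; rewrite dotC dot_lin// !(dotC w). Qed.

Lemma integral_sqr u : sqint u -> (\int[mu]_x (u x ^+ 2)%:E = (dot u u)%:E)%E.
Proof.
move=> [mmu iu]; rewrite /dot /Rintegral fineK; last first.
  have := integrable_fin_num measurableT iu.
  by congr (_ \is a fin_num); apply: eq_integral => x _ /=; rewrite expr2.
by apply: eq_integral => x _; rewrite expr2.
Qed.

(** Weighted Cauchy-Schwarz, the constant being the sum of 2^-j over j >= n. The induction uses (a +
    b)^2 <= 2 a^2 + 2 b^2 at each index instead. *)
Lemma sqr_telescope (u : nat -> R) n m : (n <= m)%N ->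
  (u m - u n) ^+ 2 <=
  2 / 2 ^+ n * \sum_(n <= j < m) 2 ^+ j * (u j.+1 - u j) ^+ 2.
Proof.
move=> nm; rewrite -(subnKC nm); move: (m - n)%N => k {m nm}; elim: k n => [|k IHk] n.
  by rewrite addn0 subrr expr0n /= big_geq// mulr0.
rewrite big_ltn ?addnS ?ltnS ?leq_addr//.
have := IHk n.+1; rewrite addSn.
move: (\sum_(_ <= _ < _) _) => s.
have -> : u (n + k).+1 - u n = (u (n + k).+1 - u n.+1) + (u n.+1 - u n) by ring.
move: (u (n + k).+1 - u n.+1) (u n.+1 - u n) => a b H.
have -> : 2 / 2 ^+ n * (2 ^+ n * b ^+ 2 + s) = 2 * b ^+ 2 + 2 * (2 / 2 ^+ n.+1 * s).
  by rewrite (exprS 2 n); field; rewrite expf_neq0.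
by have := sqr_ge0 (a - b); nra.
Qed.

(* Riesz-Fischer. The weights 2^n make the telescoping series converge
   pointwise wherever G is finite, with (h - u n)^2 <= 2^(1 - n) G there. *)
Lemma sqint_complete (u : nat -> T -> R) : (forall n, sqint (u n)) ->
  (forall n, dot (u n.+1 \- u n) (u n.+1 \- u n) <= (4 ^+ n)^-1) ->
  exists2 h, sqint h & exists C, forall n, dot (h \- u n) (h \- u n) <= C / 2 ^+ n.
Proof.
move=> su du.
have sB v w : sqint v -> sqint w -> sqint (v \- w).
  move=> sv sw; have := sqint_lin 1 (-1) sv sw.
  by congr sqint; apply/funext => x; rewrite mul1r mulN1r.
pose g n x := 2 ^+ n * (u n.+1 x - u n x) ^+ 2.
have g0 n x : 0 <= g n x by rewrite /g mulr_ge0 ?sqr_ge0 ?exprn_ge0.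
have mg n : measurable_fun setT (g n).
  apply: measurable_funM; first exact: measurable_cst.
  by apply: measurable_funX; case: (sB _ _ (su n.+1) (su n)).
pose G x := (\sum_(n <oo) (g n x)%:E)%E.
have G0 x : (0 <= G x)%E by apply: nneseries_ge0 => n _ _; rewrite lee_fin.
have mG : measurable_fun setT G.
  by apply: ge0_emeasurable_sum => [n x _ _|n _]; [rewrite lee_fin|exact/measurable_EFinP].
(* The bound is 2^n / 4^n, written as a term of the geometric series with sum 2. *)
have intg n : (\int[mu]_x (g n x)%:E <= (2 / (2 ^ (n + 1))%:R)%:E)%E.
  have := sB _ _ (su n.+1) (su n) => sd.
  rewrite (_ : (\int[mu]_x _ = (2 ^+ n)%:E * \int[mu]_x ((u n.+1 \- u n) x ^+ 2)%:E)%E).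
    rewrite integral_sqr// -EFinM lee_fin.
    apply: le_trans (ler_wpM2l _ (du n)) _; first exact: exprn_ge0.
    have -> : 4 ^+ n = 2 ^+ n * 2 ^+ n :> R.
      by rewrite -exprMn; congr (_ ^+ _); ring.
    by rewrite natrX addn1 (exprS 2 n) le_eqVlt; apply/orP; left; apply/eqP; field; rewrite expf_neq0.
  rewrite -integralZl//; last by case: sd.
have intG : (\int[mu]_x G x < +oo)%E.
  rewrite integral_nneseries//; last 2 first.
  - by move=> n; exact/measurable_EFinP.
  - by move=> n x _; rewrite lee_fin.
  apply: le_lt_trans (ltry 2).
  rewrite -(divr1 2) -(expr0 2) -(cvg_lim _ (@cvg_geometric_eseries_half R 2 0))//.
  by apply: lee_nneseries => n *; [apply: integral_ge0 => x _; rewrite lee_fin|exact: intg].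
pose D := [set x | (G x < +oo)%E].
have mD : measurable D.
  by have := emeasurable_fun_infty_o measurableT mG +oo%E; rewrite setTI.
have GD x : D x -> exists2 r : R, G x = r%:E & 0 <= r.
  move=> Dx; exists (fine (G x)); last exact: fine_ge0.
  by rewrite fineK// ge0_fin_numE.
have diffD x r n m : G x = r%:E -> (n <= m)%N -> (u m x - u n x) ^+ 2 <= 2 / 2 ^+ n * r.
  move=> Gr nm; apply: le_trans (sqr_telescope (u ^~ x) nm) _.
  rewrite ler_wpM2l ?divr_ge0 ?exprn_ge0//.
  rewrite -lee_fin -Gr -sumEFin.
  apply: le_trans (nneseries_lim_ge (m := 0) m _); last by move=> k *; rewrite lee_fin.
  rewrite [X in (_ <= X)%E](big_cat_nat (leq0n n) nm)//= leeDr//.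
  by apply: sume_ge0 => k _; rewrite lee_fin.
(* The value 0 where G is infinite makes h the everywhere pointwise limit of the restrictions of
   [u n] to D, hence measurable. *)
pose h x := if x \in D then lim (u n x @[n --> \oo]) else 0.
have cvg_h x : D x -> u n x @[n --> \oo] --> h x.
  move=> Dx; rewrite /h mem_set//; have [r Gr r0] := GD x Dx.
  apply: cauchy_cvg; apply/cauchy_exP => e e0.
  have /cvgr0Pnorm_lt/(_ (e ^+ 2)) := cvg_div_pow2 (2 * r).
  rewrite exprn_gt0// => /(_ isT) [N _ HN]; exists (u N x).
  exists N => // m /= Nm; rewrite /ball /= distrC -ltr_sqr ?nnegrE ?normr_ge0 ?(ltW e0)//.
  rewrite -normrX ger0_norm ?sqr_ge0//; apply: le_lt_trans (diffD _ _ _ _ Gr Nm) _.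
  by apply: le_lt_trans (HN N _) => //=; rewrite mulrAC ler_norm.
have mh : measurable_fun setT h.
  apply: (@measurable_fun_cvg _ _ _ setT (fun n => (u n) \_ D) h) => [n|y _].
    apply: (proj1 (measurable_restrictT (u n) mD)); apply: measurable_funTS.
    by case: (su n).
  have [yD|yD] := boolP (y \in D).
    have := cvg_h y (set_mem yD); apply: cvg_trans; apply: near_eq_cvg.
    by apply: nearW => n; rewrite patchE yD.
  rewrite /h (negbTE yD); apply: (@cvg_trans _ (0 @[n --> \oo])); last exact: cvg_cst.
  by apply: near_eq_cvg; apply: nearW => n; rewrite patchE (negbTE yD).
have h_le n x : D x -> (((h \- u n) x ^+ 2)%:E <= (2 / 2 ^+ n)%:E * G x)%E.
  move=> Dx; have [r Gr r0] := GD x Dx; rewrite Gr -EFinM lee_fin.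
  have c2 : (u m x - u n x) ^+ 2 @[m --> \oo] --> (h x - u n x) ^+ 2.
    have cB : u m x - u n x @[m --> \oo] --> h x - u n x.
      by apply: cvgB; [exact: cvg_h|exact: cvg_cst].
    by rewrite expr2; under eq_fun do rewrite expr2; exact: cvgM.
  rewrite -(cvg_lim (@Rhausdorff R) c2); apply: limr_le; first exact/cvgP/c2.
  by exists n => // m /= nm; exact: diffD.
have int_h n : (\int[mu]_x ((h \- u n) x ^+ 2)%:E <= (2 / 2 ^+ n)%:E * \int[mu]_x G x)%E.
  have [mun _] := su n.
  rewrite -ge0_integralZl//.
  apply: ae_ge0_le_integral => //.
  - by move=> x _; rewrite lee_fin sqr_ge0.
  - by apply/measurable_EFinP; apply: measurable_funX; exact: measurable_funB.
  - by move=> x _; rewrite mule_ge0// lee_fin divr_ge0// exprn_ge0.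
  - by apply: measurable_funeM.
  have : mu.-integrable setT G.
    by apply/integrableP; split=> //; under eq_integral do rewrite gee0_abs//.
  move/integrable_ae => /(_ measurableT); apply: filterS => x /(_ I) Gx _.
  by apply: h_le; rewrite /D /= -ge0_fin_numE.
have sh0 n : sqint (h \- u n).
  split; first by apply: measurable_funB => //; case: (su n).
  apply/integrableP; split.
    apply/measurable_EFinP; apply: measurable_funX.
    by apply: measurable_funB => //; case: (su n).
  under eq_integral do rewrite gee0_abs ?lee_fin ?sqr_ge0//.
  by apply: le_lt_trans (int_h n) _; apply: lte_mul_pinfty => //.
exists h.
  have := sqint_lin 1 1 (sh0 0%N) (su 0%N); congr sqint; apply/funext => x /=.
  by rewrite !mul1r subrK.
exists (2 * fine (\int[mu]_x G x)%E) => n.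
rewrite -lee_fin -(integral_sqr (sh0 n)); apply: le_trans (int_h n) _.
rewrite mulrAC [X in (_ <= X)%E]EFinM fineK ?ge0_fin_numE//; exact: integral_ge0.
Qed.

End SquareIntegrable.

(** * Gaussian weights *)

Section WeightedSpaces.
Context {R : realType}.
Implicit Types (f g : R[i] -> R[i]) (p : R * R) (b : bool) (s t : R).
Implicit Types (u v : R * R -> R).
Local Notation sqint := (sqint (@dsigma R)).
Local Notation dot := (dot (@dsigma R)).

(** This is exp (s |z|^2): s = 1 weighs the test functions, s = -1 the data and the solutions. *)
Definition gauss s p : R := expR (s * (p.1 ^+ 2 + p.2 ^+ 2)).

Lemma gaussD s t p : gauss (s + t) p = gauss s p * gauss t p.
Proof. by rewrite /gauss -expRD mulrDl. Qed.

Lemma gauss0 p : gauss 0 p = 1.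
Proof. by rewrite /gauss mul0r expR0. Qed.

Lemma gauss_half s p : gauss (s / 2) p * gauss (s / 2) p = gauss s p.
Proof. by rewrite -gaussD -splitr. Qed.

Lemma continuous_gauss s : continuous (gauss s).
Proof.
move=> p; apply: (@continuous_comp _ _ _ (fun q : R * R => s * (q.1 ^+ 2 + q.2 ^+ 2)) expR);
  last exact: continuous_expR.
apply: cvgM; first exact: cvg_cst.
by apply: cvgD; apply: cvgM; (exact: cvg_fst || exact: cvg_snd).
Qed.

Lemma is_derive_gauss s p b :
  is_derive p (axis R b) (gauss s) (2 * s * pcoord b p * gauss s p).
Proof.
apply/is_derive_sliceP.
pose e t := s * (t ^+ 2 + pcoord (~~ b) p ^+ 2).
have -> : gauss s \o slice b p = expR \o e.
  by apply/funext => t; rewrite /gauss /e /=; case: (b) => //=; rewrite addrC.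
have de : is_derive (pcoord b p) (1 : R) e (2 * s * pcoord b p).
  rewrite /e; apply: is_derive_eq.
  by rewrite /GRing.scale /= !mulr1; ring.
have dexp := is_derive_expR (e (pcoord b p)).
have := is_derive1_comp dexp de.
suff -> : gauss s p = expR (e (pcoord b p)) by rewrite [X in is_derive _ _ _ X]mulrC.
by rewrite /gauss /e; case: (b) => //=; rewrite addrC.
Qed.

(* The square root of the weight is absorbed in the function, so that the
   weighted L^2 theory is the unweighted one. *)
Definition twist s u : plane R -> R := fun p => u p * gauss (s / 2) p.

Definition L2s s f := sqint (twist s (re_part f)) /\ sqint (twist s (im_part f)).

(** The real part of the Hermitian product of f and g with weight exp (s |z|^2); [ip_conj] keeps
    track of the complex structure. *)
Definition ip s f g : R :=
  dot (twist s (re_part f)) (twist s (re_part g)) +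
  dot (twist s (im_part f)) (twist s (im_part g)).

Lemma twist_lin s (a c : R) u v :
  twist s (fun p => a * u p + c * v p) = fun p => a * twist s u p + c * twist s v p.
Proof. by apply/funext => p; rewrite /twist; ring. Qed.

Lemma L2s_lin s (a : R[i]) f g : L2s s f -> L2s s g -> L2s s (a *: f + g).
Proof.
move=> [rf imf] [rg ig]; split; rewrite ?re_lin ?im_lin !twist_lin;
  by apply: sqint_lin => //; exact: sqint_lin.
Qed.

Lemma ipC s f g : ip s f g = ip s g f.
Proof. by rewrite /ip dotC [X in _ + X]dotC. Qed.

Lemma ip_ge0 s f : 0 <= ip s f f.
Proof. by rewrite addr_ge0 ?dot_ge0. Qed.

Lemma ip_lin s t f g h : L2s s f -> L2s s g -> L2s s h ->
  ip s (t%:C *: f + g) h = t * ip s f h + ip s g h.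
Proof.
move=> [rf imf] [rg ig] [rh ih]; rewrite /ip re_lin im_lin !twist_lin.
have s1 (a c : R) u v := @sqint_lin _ _ _ (@dsigma R) a c u v.
by rewrite !dot_lin//=; try exact: s1; ring.
Qed.

Lemma ip_conj s (a : R[i]) f g : L2s s f -> L2s s g ->
  ip s (a *: f) g = ip s f (conjc a *: g).
Proof.
move=> [rf imf] [rg ig]; case: a => a c.
have reE h : re_part ((a +i* c) *: h) = fun p => a * re_part h p + - c * im_part h p.
  by apply/funext => p; rewrite /re_part /im_part /= !ReImE /=; ring.
have imE h : im_part ((a +i* c) *: h) = fun p => a * im_part h p + c * re_part h p.
  by apply/funext => p; rewrite /re_part /im_part /= !ReImE /=; ring.
have reE' h : re_part ((a -i* c) *: h) = fun p => a * re_part h p + c * im_part h p.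
  by apply/funext => p; rewrite /re_part /im_part /= !ReImE /=; ring.
have imE' h : im_part ((a -i* c) *: h) = fun p => a * im_part h p + - c * re_part h p.
  by apply/funext => p; rewrite /re_part /im_part /= !ReImE /=; ring.
rewrite /= /ip reE imE reE' imE' !twist_lin.
by rewrite !dot_lin// !dot_linr//; ring.
Qed.

Lemma continuous_sqint u (M : R) : continuous u -> (forall p, M < `|p| -> u p = 0) ->
  sqint (u : plane R -> R).
Proof.
move=> cu uM; split; first exact: continuous_measurable_plane.
apply: (@continuous_integrable _ _ M) => [p|p /uM ->]; last by rewrite expr0n.
by apply: cvgM; exact: cu.
Qed.

Lemma test_L2s s f : test_function f -> L2s s f.
Proof.
move=> [[rf imf] /bounded_supportP[M fM]].
have cG u : smooth_real u -> continuous (fun p => u p * gauss (s / 2) p).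
  move=> us p; apply: cvgM; [exact: smooth_real_continuous|exact: continuous_gauss].
by split; apply: (@continuous_sqint _ M) => [|p /fM[r0 i0]];
  [exact: cG|rewrite /twist r0 mul0r|exact: cG|rewrite /twist i0 mul0r].
Qed.

(** [du] is the derivative of u exp (s |z|^2). Integrability is recorded because two such integrals
    are later merged into one. *)
Lemma Rintegral_derive_gauss s u (M : R) b : smooth_real u ->
  (forall p, M < `|p| -> u p = 0) ->
  let du p := ('D_(axis R b) u p + 2 * s * pcoord b p * u p) * gauss s p in
  (@dsigma R).-integrable setT (EFin \o (du : plane R -> R)) /\
  \int[@dsigma R]_p du p = 0.
Proof.
move=> us uM du.
have dug p : is_derive p (axis R b) (u * gauss s) (du p).
  have ud : is_derive p (axis R b) u ('D_(axis R b) u p).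
    by apply: derivableP; exact: smooth_real_derivable.
  have H := is_deriveM ud (is_derive_gauss s p b).
  by apply: (@is_derive_eq _ _ _ _ _ _ _ _ H); rewrite /du /GRing.scale /=; ring.
have duE : 'D_(axis R b) (u * gauss s) = du.
  by apply/funext => p; exact: (@derive_val _ _ _ _ _ _ _ (dug p)).
have dus : smooth_real ('D_(axis R b) u) by exact: smooth_real_derive.
have cdu : continuous du.
  move=> p; apply: cvgM; last exact: continuous_gauss.
  apply: cvgD; first exact: (smooth_real_continuous dus).
  apply: (@cvgM _ _ (nbhs p) _ (fun q => 2 * s * pcoord b q) u);
    last exact: (smooth_real_continuous us).
  by apply: cvgM; [exact: cvg_cst|exact: continuous_pcoord].
have duM p : M < `|p| -> du p = 0.
  by move=> Mp; rewrite /du uM// (@derive_bounded_support R u M b uM p Mp) mulr0 addr0 mul0r.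
split; first exact: (continuous_integrable cdu duM).
rewrite /Rintegral -duE (@integral_derive0 _ _ M)//.
- rewrite duE; exact: cdu.
- by move=> p Mp; rewrite -[LHS]/(u p * gauss s p) uM// mul0r.
Qed.

Lemma twist_mul s u v p : twist s u p * twist s v p = u p * v p * gauss s p.
Proof. by rewrite /twist mulrACA gauss_half. Qed.

Lemma ip_Rintegral s f g : L2s s f -> L2s s g ->
  (@dsigma R).-integrable setT (EFin \o ((fun p =>
    (re_part f p * re_part g p + im_part f p * im_part g p) * gauss s p) : plane R -> R)) /\
  ip s f g = \int[@dsigma R]_p
    ((re_part f p * re_part g p + im_part f p * im_part g p) * gauss s p).
Proof.
move=> [rf imf] [rg ig]; have ir := sqint_mul rf rg; have ii := sqint_mul imf ig.
have E p : twist s (re_part f) p * twist s (re_part g) p +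
    twist s (im_part f) p * twist s (im_part g) p =
    (re_part f p * re_part g p + im_part f p * im_part g p) * gauss s p.
  by rewrite !twist_mul mulrDl.
split; first by have := integrableD measurableT ir ii; apply: eq_integrable => // p _ /=; rewrite -E.
rewrite /ip /dot -RintegralD//; by apply: eq_Rintegral => p _; exact: E.
Qed.

(* The difference of the two integrands is the divergence of half of
   (Re (f conj g), Im (f conj g)) exp |z|^2, as d/dz exp |z|^2 = conj z exp |z|^2. *)
Lemma ip_adjoint f g : test_function f -> test_function g ->
  ip 1 (lowering f) g = ip 1 f (raising g).
Proof.
move=> tf tg; have [_ /bounded_supportP[M fM]] := tf.
have [[[rf imf] rg] ig] := (test_re tf, test_im tf, test_re tg, test_im tg).
have [iL ->] := ip_Rintegral (test_L2s 1 (test_lowering tf)) (test_L2s 1 tg).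
have [iR ->] := ip_Rintegral (test_L2s 1 tf) (test_L2s 1 (test_raising tg)).
apply/eqP; rewrite -subr_eq0 -RintegralB//.
have smul u v := @smooth_realM R u v.
pose P p := 1 * (re_part f p * re_part g p) + 1 * (im_part f p * im_part g p).
pose Q p := 1 * (im_part f p * re_part g p) + - 1 * (re_part f p * im_part g p).
have sP : smooth_real P by apply: smooth_real_lin; exact: smooth_realM.
have sQ : smooth_real Q by apply: smooth_real_lin; exact: smooth_realM.
have PM p : M < `|p| -> P p = 0 by rewrite /P => /fM[-> ->]; rewrite !mul0r !mulr0 addr0.
have QM p : M < `|p| -> Q p = 0 by rewrite /Q => /fM[-> ->]; rewrite !mul0r !mulr0 addr0.
have [iP P0] := Rintegral_derive_gauss 1 false sP PM.
have [iQ Q0] := Rintegral_derive_gauss 1 true sQ QM.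
have DM u v b p : smooth_real u -> smooth_real v ->
    'D_(axis R b) (fun q => u q * v q) p = u p * 'D_(axis R b) v p + v p * 'D_(axis R b) u p.
  move=> us vs; apply: (@derive_val _ _ _ _ _ _ _ (is_deriveM (derivableP _) (derivableP _))).
    exact: smooth_real_derivable.
  exact: smooth_real_derivable.
have DP p : 'D_(axis R false) P p =
    1 * (re_part f p * 'D_(axis R false) (re_part g) p + re_part g p * 'D_(axis R false) (re_part f) p) +
    1 * (im_part f p * 'D_(axis R false) (im_part g) p + im_part g p * 'D_(axis R false) (im_part f) p).
  by rewrite (derive_smooth_lin _ _ _ _ (smul _ _ rf rg) (smul _ _ imf ig)) !DM.
have DQ p : 'D_(axis R true) Q p =
    1 * (im_part f p * 'D_(axis R true) (re_part g) p + re_part g p * 'D_(axis R true) (im_part f) p) +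
    - 1 * (re_part f p * 'D_(axis R true) (im_part g) p + im_part g p * 'D_(axis R true) (re_part f) p).
  by rewrite (derive_smooth_lin _ _ _ _ (smul _ _ imf rg) (smul _ _ rf ig)) !DM.
rewrite (_ : Rintegral _ _ _ = 2^-1 * (\int[@dsigma R]_p (('D_(axis R false) P p +
   2 * 1 * pcoord false p * P p) * gauss 1 p) + \int[@dsigma R]_p (('D_(axis R true) Q p +
   2 * 1 * pcoord true p * Q p) * gauss 1 p))).
  by rewrite P0 Q0 addr0 mulr0.
rewrite -RintegralD// -RintegralZl//; last first.
  by have := integrableD measurableT iP iQ; exact: eq_integrable.
apply: eq_Rintegral => p _; rewrite re_lowering im_lowering re_raising im_raising.
rewrite DP DQ /P /Q.
move: ('D_(axis R false) (re_part f) p) ('D_(axis R true) (re_part f) p)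
    ('D_(axis R false) (im_part f) p) ('D_(axis R true) (im_part f) p)
    ('D_(axis R false) (re_part g) p) ('D_(axis R true) (re_part g) p)
    ('D_(axis R false) (im_part g) p) ('D_(axis R true) (im_part g) p).
move: (re_part f p) (im_part f p) (re_part g p) (im_part g p) (gauss 1 p).
move: (pcoord false p) (pcoord true p) => x y a1 a2 a3 a4 w d1 d2 d3 d4 d5 d6 d7 d8.
by field.
Qed.

End WeightedSpaces.

(** * Weighted L^2 spaces and the isometry between opposite weights *)

Section WeightedL2.
Context {R : realType}.
Implicit Types (f g : R[i] -> R[i]) (p : R * R) (b : bool) (s t : R).
Implicit Types (u v : R * R -> R).
Local Notation sqint := (sqint (@dsigma R)).
Local Notation dot := (dot (@dsigma R)).

Lemma measurable_gauss s : measurable_fun [set: plane R] (gauss s).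
Proof. by apply: continuous_measurable_plane; exact: continuous_gauss. Qed.

Lemma measurable_twist s u :
  measurable_fun [set: plane R] u <-> measurable_fun [set: plane R] (twist s u).
Proof.
split=> mu; first by apply: measurable_funM => //; exact: measurable_gauss.
have -> : u = fun p => twist s u p * gauss (- (s / 2)) p.
  by apply/funext => p; rewrite /twist -mulrA -gaussD subrr gauss0 mulr1.
by apply: measurable_funM => //; exact: measurable_gauss.
Qed.

Lemma modulus_sqr (z : R[i]) : modulus z ^+ 2 = complex.Re z ^+ 2 + complex.Im z ^+ 2.
Proof. by case: z => x y; rewrite /modulus /= sqr_sqrtr// addr_ge0 ?sqr_ge0. Qed.

Lemma weight_gauss p : expR (- modulus (cplx p) ^+ 2) = gauss (-1) p.
Proof. by rewrite modulus_sqr /gauss mulN1r. Qed.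

Lemma weighted_modulus f p :
  modulus (f (cplx p)) ^+ 2 * expR (- modulus (cplx p) ^+ 2) =
  twist (-1) (re_part f) p ^+ 2 + twist (-1) (im_part f) p ^+ 2.
Proof.
by rewrite weight_gauss modulus_sqr mulrDl !(expr2 (twist _ _ _)) !twist_mul.
Qed.

Lemma sqnormwE f : L2s (-1) f -> sqnormw f = (ip (-1) f f)%:E.
Proof.
move=> [sr si]; rewrite /ip EFinD -!integral_sqr// -ge0_integralD//.
- by apply: eq_integral => p _; rewrite weighted_modulus EFinD.
- by move=> p _; rewrite lee_fin sqr_ge0.
- by apply/measurable_EFinP; apply: measurable_funX; case: sr.
- by move=> p _; rewrite lee_fin sqr_ge0.
- by apply/measurable_EFinP; apply: measurable_funX; case: si.
Qed.

Lemma L2w_L2s f : L2w f -> L2s (-1) f.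
Proof.
move=> [[[mr mi] _] fin].
have mtr := (measurable_twist (-1) _).1 mr; have mti := (measurable_twist (-1) _).1 mi.
have tw_int u : measurable_fun [set: plane R] (twist (-1) u) ->
    (forall p, twist (-1) u p ^+ 2 <=
      modulus (f (cplx p)) ^+ 2 * expR (- modulus (cplx p) ^+ 2)) ->
    sqint (twist (-1) u).
  move=> mu ule; split=> //; apply/integrableP; split.
    by apply/measurable_EFinP; apply: measurable_funX.
  apply: le_lt_trans fin; apply: ge0_le_integral => //.
  - by apply: measurableT_comp => //; apply/measurable_EFinP; apply: measurable_funX.
  - apply/measurable_EFinP; rewrite (_ : (fun p => _) = fun p =>
      twist (-1) (re_part f) p ^+ 2 + twist (-1) (im_part f) p ^+ 2).
      by apply: measurable_funD; apply: measurable_funX.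
    by apply/funext => p; exact: weighted_modulus.
  - by move=> p _; rewrite /= ger0_norm ?sqr_ge0// lee_fin.
split; apply: tw_int => // p; rewrite weighted_modulus ?lerDl ?lerDr sqr_ge0//.
Qed.

(** Local integrability holds because the weight is bounded below on compact sets. M bounds the max
    norm, so |z|^2 <= M^2 + M^2, which explains the constant. *)
Lemma L2s_L2w f : L2s (-1) f -> L2w f.
Proof.
move=> sf; have [[mr ir] [mi ii]] := sf; have fin := sqnormwE sf.
have cm : cmeasurable f by split; apply/(measurable_twist (-1)).
split; last by rewrite fin ltry.
split=> // K cK; have mK := compact_measurable_plane cK.
have [N [_ KN]] := compact_bounded cK; pose M := `|N| + 1.
have KM p : K p -> `|p| <= M.
  by apply: KN; rewrite (le_lt_trans (ler_norm _))// ltrDl.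
have M0 : 0 <= M by rewrite addr_ge0.
have mmod : measurable_fun [set: plane R] (fun p => (modulus (f (cplx p)) ^+ 2)%:E).
  apply/measurable_EFinP; rewrite (_ : (fun p => _) = fun p =>
    re_part f p ^+ 2 + im_part f p ^+ 2); last first.
    by apply/funext => p; exact: modulus_sqr.
  by case: cm => ? ?; apply: measurable_funD; apply: measurable_funX.
have mmodw : measurable_fun [set: plane R] (fun p =>
    (modulus (f (cplx p)) ^+ 2 * expR (- modulus (cplx p) ^+ 2))%:E).
  apply/measurable_EFinP; rewrite (_ : (fun p => _) = fun p =>
    twist (-1) (re_part f) p ^+ 2 + twist (-1) (im_part f) p ^+ 2).
    by apply: measurable_funD; apply: measurable_funX.
  by apply/funext => p; exact: weighted_modulus.
have w0 p : (0 <= (modulus (f (cplx p)) ^+ 2 * expR (- modulus (cplx p) ^+ 2))%:E)%E.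
  by rewrite lee_fin mulr_ge0 ?sqr_ge0 ?expR_ge0.
apply: (@le_lt_trans _ _ ((expR (M ^+ 2 + M ^+ 2))%:E * sqnormw f)%E); last first.
  by rewrite fin -EFinM ltry.
rewrite /sqnormw -ge0_integralZl//.
apply: (@le_trans _ _ (\int[@dsigma R]_(p in K) ((expR (M ^+ 2 + M ^+ 2))%:E *
   (modulus (f (cplx p)) ^+ 2 * expR (- modulus (cplx p) ^+ 2))%:E))%E).
  apply: ge0_le_integral => //.
  - by move=> p _; rewrite lee_fin sqr_ge0.
  - exact: measurable_funTS.
  - by apply: measurable_funTS; exact: measurable_funeM.
  - move=> p /KM; rewrite prod_normE ge_max => /andP[p1 p2].
    rewrite -EFinM lee_fin mulrCA ler_peMr ?sqr_ge0// -expRD -expR0 ler_expR.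
    rewrite modulus_sqr /= subr_ge0 lerD// -(ger0_norm M0) -real_normK ?num_real//.
      by rewrite -[leRHS]real_normK ?num_real// lerXn2r ?nnegrE ?normr_ge0 ?(ger0_norm M0).
    by rewrite -[leRHS]real_normK ?num_real// lerXn2r ?nnegrE ?normr_ge0 ?(ger0_norm M0).
apply: ge0_subset_integral => //; first exact: measurable_funeM.
by move=> p _; rewrite mule_ge0// lee_fin expR_ge0.
Qed.

Lemma re_sub f g : re_part (f - g) = re_part f \- re_part g.
Proof. by apply/funext => p; rewrite /re_part /= Re_add Re_opp. Qed.

Lemma im_sub f g : im_part (f - g) = im_part f \- im_part g.
Proof. by apply/funext => p; rewrite /im_part /= Im_add Im_opp. Qed.

Lemma twist_sub s u v : twist s (u \- v) = twist s u \- twist s v.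
Proof. by apply/funext => p; rewrite /twist mulrBl. Qed.

Lemma L2s_scale s (a : R[i]) f : L2s s f -> L2s s (a *: f).
Proof. exact: (dom_scale (@L2s_lin R s)). Qed.

Lemma L2s_complete s (f : nat -> R[i] -> R[i]) : (forall n, L2s s (f n)) ->
  (forall n, ip s (f n.+1 - f n) (f n.+1 - f n) <= (4 ^+ n)^-1) ->
  exists2 h, L2s s h & ip s (h - f n) (h - f n) @[n --> \oo] --> 0.
Proof.
move=> sf df.
have ipB h g : ip s (h - g) (h - g) =
    dot (twist s (re_part h) \- twist s (re_part g)) (twist s (re_part h) \- twist s (re_part g)) +
    dot (twist s (im_part h) \- twist s (im_part g)) (twist s (im_part h) \- twist s (im_part g)).
  by rewrite /ip re_sub im_sub !twist_sub.
have [n|n|hr shr [Cr hrC]] := @sqint_complete _ _ _ (@dsigma R)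
  (fun n => twist s (re_part (f n))).
- by case: (sf n).
- by apply: le_trans (df n); rewrite ipB lerDl dot_ge0.
have [n|n|hi shi [Ci hiC]] := @sqint_complete _ _ _ (@dsigma R)
  (fun n => twist s (im_part (f n))).
- by case: (sf n).
- by apply: le_trans (df n); rewrite ipB lerDr dot_ge0.
pose G p := gauss (- (s / 2)) p.
pose h (z : R[i]) := let p := (complex.Re z, complex.Im z) in
  (hr p * G p) +i* (hi p * G p).
have rh : twist s (re_part h) = hr.
  by apply/funext => -[x y]; rewrite /twist /re_part /= -mulrA -gaussD addNr gauss0 mulr1.
have ih : twist s (im_part h) = hi.
  by apply/funext => -[x y]; rewrite /twist /im_part /= -mulrA -gaussD addNr gauss0 mulr1.
exists h; first by split; rewrite ?rh ?ih.
apply: (@squeeze_cvgr _ _ _ _ (cst 0) (fun n => (Cr + Ci) / 2 ^+ n)).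
- apply: nearW => n; rewrite ip_ge0 /= ipB rh ih mulrDl lerD//.
- exact: cvg_cst.
- exact: cvg_div_pow2.
Qed.

(* Antilinear isometry from L^2(exp |z|^2) onto L^2(exp (- |z|^2)) that turns
   the inner product into the bilinear pairing of [cintegral]. *)
Definition conj_gauss f z : R[i] :=
  conjc (f z) * (gauss 1 (complex.Re z, complex.Im z))%:C.

Lemma re_conj_gauss f p : re_part (conj_gauss f) p = re_part f p * gauss 1 p.
Proof.
by case: p => x y; rewrite /re_part /conj_gauss Re_mul /= mulr0 subr0; case: (f _).
Qed.

Lemma im_conj_gauss f p : im_part (conj_gauss f) p = - im_part f p * gauss 1 p.
Proof.
by case: p => x y; rewrite /im_part /conj_gauss Im_mul /= mulr0 add0r; case: (f _).
Qed.

Lemma twist_conj_gauss f :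
  twist (-1) (re_part (conj_gauss f)) = twist 1 (re_part f) /\
  twist (-1) (im_part (conj_gauss f)) = twist 1 (fun p => - im_part f p).
Proof.
have E p : gauss 1 p * gauss (-1 / 2) p = gauss (1 / 2) p.
  by rewrite -gaussD [X in X + _]splitr mulN1r mul1r addrK.
by split; apply/funext => p; rewrite /twist ?re_conj_gauss ?im_conj_gauss -mulrA E.
Qed.

Lemma twist_opp s u : twist s (fun p => - u p) = fun p => - twist s u p.
Proof. by apply/funext => p; rewrite /twist mulNr. Qed.

Lemma sqint_opp (u : plane R -> R) : sqint u -> sqint (fun p => - u p).
Proof.
move=> su; have := sqint_lin (-1) 0 su su; congr sqint.
by apply/funext => p; rewrite mul0r addr0 mulN1r.
Qed.

Lemma L2s_conj_gauss f : L2s 1 f -> L2s (-1) (conj_gauss f).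
Proof.
move=> [sr si]; have [rE iE] := twist_conj_gauss f.
by split; rewrite ?rE ?iE ?twist_opp//; exact: sqint_opp.
Qed.

Lemma ip_conj_gauss f : ip (-1) (conj_gauss f) (conj_gauss f) = ip 1 f f.
Proof.
rewrite /ip; have [-> ->] := twist_conj_gauss f; rewrite twist_opp; congr (_ + _).
by apply: eq_Rintegral => p _; rewrite mulrNN.
Qed.

Lemma conj_gauss_lin (a : R[i]) f g :
  conj_gauss (a *: f + g) = conjc a *: conj_gauss f + conj_gauss g.
Proof.
apply/funext => z; rewrite /conj_gauss -[RHS]/(conjc a * (conj_gauss f z) + conj_gauss g z).
rewrite -[(a *: f + g) z]/(a * f z + g z) rmorphD rmorphM mulrDl.
by rewrite /conj_gauss mulrA.
Qed.

Lemma conj_gaussZ (a : R[i]) f : conj_gauss (a *: f) = conjc a *: conj_gauss f.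
Proof.
apply/funext => z; rewrite -[RHS]/(conjc a * conj_gauss f z) /conj_gauss.
by rewrite -[(a *: f) z]/(a * f z) rmorphM mulrA.
Qed.

Lemma Re_cintegral f g : L2s (-1) f -> L2s 1 g ->
  complex.Re (cintegral (fun z => f z * g z)) = ip (-1) f (conj_gauss g).
Proof.
move=> [rf imf] [rg ig]; rewrite /cintegral /= /ip.
have [-> ->] := twist_conj_gauss g; rewrite twist_opp /dot.
have E u v p : twist (-1) u p * twist 1 v p = u p * v p.
  by rewrite /twist mulrACA -gaussD mulN1r mul1r addNr gauss0 mulr1.
rewrite -RintegralD//; last 2 first.
- exact: sqint_mul.
- by apply: sqint_mul => //; exact: sqint_opp.
by apply: eq_Rintegral => p _; rewrite mulrN !E /re_part Re_mul.
Qed.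

(** Im w = Re (- i w), with - i moved onto the second factor: identities of real parts, valid for
    all test functions, thus give identities of complex integrals. *)
Lemma Im_cintegral f g :
  complex.Im (cintegral (fun z => f z * g z)) =
  complex.Re (cintegral (fun z => f z * ((0 -i* 1) *: g) z)).
Proof.
rewrite /cintegral /=; apply: eq_Rintegral => p _.
rewrite /im_part /re_part -[(_ *: g) _]/((0 -i* 1) * g (cplx p)) Im_mul Re_mul.
by rewrite Re_mul Im_mul /=; ring.
Qed.

Let ae_dsigma := ae_filter_ringOfSetsType (@dsigma R).

Lemma ip_ae_equal s f f' g : L2s s f -> L2s s f' -> L2s s g -> ae_equal f f' ->
  ip s f g = ip s f' g.
Proof.
move=> [[mr _] [mi _]] [[mr' _] [mi' _]] [[mrg _] [mig _]] ff'.
rewrite /ip /dot; congr (_ + _); congr fine; apply: ae_eq_integral => //.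
- by apply/measurable_EFinP; exact: measurable_funM.
- by apply/measurable_EFinP; exact: measurable_funM.
- by apply: (filterS (Filter := ae_dsigma)) ff' => p fE _; rewrite /= /twist /re_part fE.
- by apply/measurable_EFinP; exact: measurable_funM.
- by apply/measurable_EFinP; exact: measurable_funM.
- by apply: (filterS (Filter := ae_dsigma)) ff' => p fE _; rewrite /= /twist /im_part fE.
Qed.

Lemma ip_eq0 s f g : L2s s f -> L2s s g -> ip s (f - g) (f - g) = 0 -> ae_equal f g.
Proof.
move=> sf sg.
have [sr si] : L2s s (f - g).
  by rewrite addrC -scaleN1r; exact: L2s_lin.
have dot_eq0 (u : plane R -> R) : sqint u -> dot u u = 0 ->
    {ae @dsigma R, forall p, u p = 0}.
  move=> su u0; have := integral_sqr su; rewrite u0 => iu.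
  have /ae_eq_integral_abs : (\int[@dsigma R]_p `| (u p ^+ 2)%:E | = 0)%E.
    by apply: etrans iu; apply: eq_integral => p _; rewrite gee0_abs// lee_fin sqr_ge0.
  have mu : measurable_fun setT (fun p => (u p ^+ 2)%:E).
    by apply/measurable_EFinP; apply: measurable_funX; case: su.
  move=> /(_ measurableT mu); apply: (filterS (Filter := ae_dsigma)) => p /(_ I) /= [] /eqP.
  by rewrite sqrf_eq0 => /eqP.
rewrite /ip => /eqP; rewrite paddr_eq0 ?dot_ge0// => /andP[/eqP r0 /eqP i0].
have := filterI (Filter := ae_dsigma) (dot_eq0 _ sr r0) (dot_eq0 _ si i0); apply: (filterS (Filter := ae_dsigma)) => p [].
rewrite re_sub im_sub /twist => /eqP; rewrite mulf_eq0 (gt_eqF (expR_gt0 _)) orbF subr_eq0.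
move=> /eqP rE /eqP; rewrite mulf_eq0 (gt_eqF (expR_gt0 _)) orbF subr_eq0 => /eqP iE.
by move: rE iE; rewrite /re_part /im_part; case: (f _) (g _) => ? ? [? ?] /= -> ->.
Qed.

End WeightedL2.

(** * The solution operator *)

Section Solution.
Context {R : realType} (n : nat) (c : R[i]) (beta : R) (hbeta : 1 <= `|beta|).
Implicit Types (f g u v w phi psi : R[i] -> R[i]) (p : R * R).

(** Here k is [n.+1]; the sign (-1)^k of the transpose is absorbed by [raising]. *)
Definition transpose_op phi : R[i] -> R[i] :=
  beta%:C *: iter n.+1 raising phi + c *: phi.

Lemma test0 : test_function (0 : R[i] -> R[i]).
Proof.
split; last by exists 0.
have r0 : re_part (0 : R[i] -> R[i]) = cst 0 by apply/funext => p.
have i0 : im_part (0 : R[i] -> R[i]) = cst 0 by apply/funext => p.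
by split; rewrite ?r0 ?i0; exact: smooth_real_cst.
Qed.

Lemma test_scale (a : R[i]) phi : test_function phi -> test_function (a *: phi).
Proof. by move=> tp; rewrite -[_ *: _]addr0; exact: test_lin tp test0. Qed.

Lemma test_iter_raising k phi :
  test_function phi -> test_function (iter k raising phi).
Proof. by move=> tp; elim: k => //= k; exact: test_raising. Qed.

Lemma iter_raising_lin k (a : R[i]) phi psi : test_function phi -> test_function psi ->
  iter k raising (a *: phi + psi) = a *: iter k raising phi + iter k raising psi.
Proof.
move=> tp ts; elim: k => //= k ->.
by rewrite raising_lin//; exact: test_iter_raising.
Qed.

Lemma test_transpose_op phi : test_function phi -> test_function (transpose_op phi).
Proof. by move=> tp; apply: test_lin (test_scale _ tp); exact: test_iter_raising. Qed.

Lemma transpose_op_lin (a : R[i]) phi psi : test_function phi -> test_function psi ->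
  transpose_op (a *: phi + psi) = a *: transpose_op phi + transpose_op psi.
Proof.
move=> tp ts; rewrite /transpose_op iter_raising_lin// !scalerDr !scalerA.
by rewrite (mulrC beta%:C) (mulrC c) addrACA.
Qed.

Lemma transpose_opZ (a : R[i]) phi : test_function phi ->
  transpose_op (a *: phi) = a *: transpose_op phi.
Proof.
move=> tp; have := transpose_op_lin a tp test0; rewrite addr0 => ->.
have := transpose_op_lin (-1) test0 test0.
by rewrite scaler0 addr0 scaleN1r addNr => ->; rewrite addr0.
Qed.

Lemma transpose_opE phi : test_function phi -> forall z,
  (-1) ^+ n.+1 * beta%:C * iter n.+1 (@dbar R) phi z + c * phi z = transpose_op phi z.
Proof.
move=> tp z.
have dbarE f : dbar f = -1 *: raising f.
  by apply/funext => x; rewrite scaleN1r -[RHS]/(- - dbar f x) opprK.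
have raisingZ (a : R[i]) f : test_function f -> raising (a *: f) = a *: raising f.
  move=> tf; have := raising_lin a tf test0; rewrite addr0 => ->.
  have := raising_lin (-1) test0 test0.
  by rewrite scaler0 addr0 scaleN1r addNr => ->; rewrite addr0.
have -> : iter n.+1 (@dbar R) phi = (-1) ^+ n.+1 *: iter n.+1 raising phi.
  elim: n.+1 => [|k IHk]; first by rewrite scale1r.
  rewrite iterS IHk dbarE raisingZ; last exact: test_iter_raising.
  by rewrite scalerA -exprS.
rewrite -[((-1) ^+ n.+1 *: iter n.+1 raising phi) z]/((-1) ^+ n.+1 * iter n.+1 raising phi z).
rewrite mulrACA -expr2 -exprM mulnC exprM sqrrN expr1n expr1n mul1r.
by [].
Qed.

Lemma transpose_op_ge phi : test_function phi ->
  (n.+1)`!%:R * ip 1 phi phi <= ip 1 (transpose_op phi) (transpose_op phi).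
Proof.
move=> tp.
have L := @lower_bound _ _ (L2s 1) (ip 1) (@L2s_lin R 1) (@ipC R 1) (@ip_lin R 1)
  (@ip_ge0 R 1) (@test_function R) (@raising R) (@lowering R) (@conjc R)
  (@test_lin R) (@test_L2s R 1) (@test_raising R) (@test_lowering R)
  (@raising_lin R) (@lowering_lin R) (@lowering_raising R) (@ip_adjoint R)
  (@ip_conj R 1) (@conjcK R) n beta c phi tp.
apply: le_trans L; rewrite ler_wpM2r ?ip_ge0// ler_peMl//.
by rewrite -real_normK ?num_real// exprn_ege1.
Qed.

(** The real part of the weak equation; replacing phi by - i phi recovers the imaginary part. *)
Definition weak_sol f u := forall phi, test_function phi ->
  ip (-1) u (conj_gauss (transpose_op phi)) = ip (-1) f (conj_gauss phi).

(* u is orthogonal to whatever is orthogonal to the range of the transpose;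
   this form of membership in its closure is visibly linear in u. *)
Definition minimal u := forall w, L2s (-1) w ->
  (forall phi, test_function phi -> ip (-1) w (conj_gauss (transpose_op phi)) = 0) ->
  ip (-1) u w = 0.

Let L2s_conj_op phi : test_function phi ->
  L2s (-1) (conj_gauss (transpose_op phi)).
Proof. by move=> tp; apply/L2s_conj_gauss/test_L2s/test_transpose_op. Qed.

Let L2s_conj_test phi : test_function phi -> L2s (-1) (conj_gauss phi).
Proof. by move=> tp; apply/L2s_conj_gauss/test_L2s. Qed.

(** [conj_gauss] is antilinear, so its composite with the transpose is linear over the reals only,
    which is what [minimal_solution] asks. The constant is Cauchy-Schwarz followed by
    [transpose_op_ge]. *)
Lemma minimal_weak_sol f : L2s (-1) f -> exists u, [/\ L2s (-1) u, weak_sol f u,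
  minimal u & ip (-1) u u <= ip (-1) f f / (n.+1)`!%:R].
Proof.
move=> sf; have conj_real (t : R) : conjc t%:C = t%:C by rewrite /= oppr0.
have fact0 : 0 < (n.+1)`!%:R :> R by rewrite ltr0n fact_gt0.
have [|t phi psi tp ts|phi tp|t phi psi tp ts|t phi psi tp ts||phi tp|u [su usol uK umin]] :=
  @minimal_solution _ _ (L2s (-1)) (ip (-1)) (@L2s_lin R (-1)) (@ipC R (-1))
  (@ip_lin R (-1)) (@ip_ge0 R (-1)) (@L2s_complete R (-1)) (@test_function R)
  (fun phi => conj_gauss (transpose_op phi)) (fun phi => ip (-1) f (conj_gauss phi))
  (ip (-1) f f / (n.+1)`!%:R).
- exact: test0.
- exact: test_lin.
- exact: L2s_conj_op.
- by rewrite transpose_op_lin// conj_gauss_lin conj_real.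
- rewrite conj_gauss_lin conj_real !(ipC _ f) ip_lin//; exact: L2s_conj_test.
- by rewrite divr_ge0 ?ip_ge0// ltW.
- have := cauchy_schwarz (@L2s_lin R (-1)) (@ipC R (-1)) (@ip_lin R (-1))
    (@ip_ge0 R (-1)) sf (L2s_conj_test tp).
  move=> cs; apply: le_trans cs _; rewrite !ip_conj_gauss mulrAC -mulrA ler_wpM2l ?ip_ge0//.
  by rewrite ler_pdivlMr// mulrC transpose_op_ge.
by exists u.
Qed.

(** The difference u - v is orthogonal to the range, so minimality of u and of v makes it orthogonal
    to itself. *)
Lemma minimal_unique u v : L2s (-1) u -> L2s (-1) v -> minimal u -> minimal v ->
  (forall phi, test_function phi ->
    ip (-1) u (conj_gauss (transpose_op phi)) = ip (-1) v (conj_gauss (transpose_op phi))) ->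
  ae_equal u v.
Proof.
move=> su sv um vm uv.
have suv : L2s (-1) (u - v) by exact: (dom_sub (@L2s_lin R (-1))).
have ipB w : L2s (-1) w -> ip (-1) (u - v) w = ip (-1) u w - ip (-1) v w.
  exact: (ipBl (@L2s_lin R (-1)) (@ip_lin R (-1))).
have orth phi : test_function phi -> ip (-1) (u - v) (conj_gauss (transpose_op phi)) = 0.
  by move=> tp; rewrite ipB ?uv ?subrr//; exact: L2s_conj_op.
by apply: (ip_eq0 su sv); rewrite ipB// um// vm// subr0.
Qed.

(** The complex scalar is moved onto the test function, where the conjugations of [ip_conj] and
    [conj_gauss] cancel. *)
Lemma weak_sol_lin (a : R[i]) f g u v : L2s (-1) f -> L2s (-1) g ->
  L2s (-1) u -> L2s (-1) v -> weak_sol f u -> weak_sol g v ->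
  weak_sol (a *: f + g) (a *: u + v).
Proof.
move=> sf sg su sv fu gv phi tp.
have D w1 w2 w3 : L2s (-1) w1 -> L2s (-1) w2 -> L2s (-1) w3 ->
    ip (-1) (w1 + w2) w3 = ip (-1) w1 w3 + ip (-1) w2 w3.
  exact: (ipDl (@ip_lin R (-1))).
have so := L2s_conj_op tp; have st := L2s_conj_test tp.
rewrite !D// ?gv//; try exact: L2s_scale.
by rewrite !ip_conj// -!conj_gaussZ -transpose_opZ// fu//; exact: test_scale.
Qed.

(** Pairing a u with w is pairing u with conj a w, again orthogonal to the range because the range
    is a complex subspace. *)
Lemma minimal_lin (a : R[i]) u v : L2s (-1) u -> L2s (-1) v ->
  minimal u -> minimal v -> minimal (a *: u + v).
Proof.
move=> su sv um vm w sw worth.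
have D : ip (-1) (a *: u + v) w = ip (-1) (a *: u) w + ip (-1) v w.
  by apply: (ipDl (@ip_lin R (-1))) => //; exact: L2s_scale.
rewrite D vm// addr0 ip_conj//; apply: um => [|phi tp]; first exact: L2s_scale.
rewrite ip_conj ?conjcK//; last exact: L2s_conj_op.
by rewrite -{1}(conjcK a) -conj_gaussZ -transpose_opZ// worth//; exact: test_scale.
Qed.

Lemma weak_sol_weak_solution f u : L2w f -> L2w u -> weak_sol f u ->
  weak_solution n.+1 beta c u f.
Proof.
move=> wf wu fu; split=> [|phi sphi cphi]; first by case: wu.
have tp : test_function phi by split=> //; apply/compactly_supportedP.
rewrite (_ : (fun z => u z * _) = (fun z => u z * transpose_op phi z)); last first.
  by apply/funext => z; rewrite transpose_opE.
have [sf su] := (L2w_L2s wf, L2w_L2s wu).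
have ReE psi : test_function psi ->
    complex.Re (cintegral (fun z => u z * transpose_op psi z)) =
    complex.Re (cintegral (fun z => f z * psi z)).
  move=> ts; rewrite !Re_cintegral//; first exact: fu.
    exact: test_L2s.
  by apply: test_L2s; exact: test_transpose_op.
have := ReE _ tp; have : complex.Im (cintegral (fun z => u z * transpose_op phi z)) =
    complex.Im (cintegral (fun z => f z * phi z)).
  by rewrite !Im_cintegral -transpose_opZ// ReE//; exact: test_scale.
by case: (cintegral _) (cintegral _) => ? ? [? ?] /= -> ->.
Qed.

Lemma solution_operator : exists T : (R[i] -> R[i]) -> (R[i] -> R[i]),
  forall f, L2w f -> [/\ L2s (-1) (T f), weak_sol f (T f), minimal (T f) &
    ip (-1) (T f) (T f) <= ip (-1) f f / (n.+1)`!%:R].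
Proof.
have /choice[T TP] f : exists u, L2w f -> [/\ L2s (-1) u, weak_sol f u, minimal u &
    ip (-1) u u <= ip (-1) f f / (n.+1)`!%:R].
  (* Off [L2w] the value f is a placeholder about which nothing is claimed. *)
  have [wf|nwf] := pselect (L2w f); last by exists f.
  by have [u uP] := minimal_weak_sol (L2w_L2s wf); exists u.
by exists T.
Qed.

End Solution.

Lemma normwE (R : realType) (f : R[i] -> R[i]) : L2s (-1) f ->
  normw f = (Num.sqrt (ip (-1) f f))%:E.
Proof. by move=> sf; rewrite /normw sqnormwE// poweR_EFin powR12_sqrt ?ip_ge0. Qed.

Theorem theorem4p2 (R : realType) (k : nat) (hk : (1 <= k)%N) (c : R[i])
    (beta : R) (hbeta : 1 <= `|beta|) :
  exists T : (R[i] -> R[i]) -> (R[i] -> R[i]),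
    [/\ linear_L2w T,
        bounded_L2w T,
        forall f, L2w f -> weak_solution k beta c (T f) f
      & (opnorm T ^+ 2 <= ((k`!)%:R^-1)%:E)%E].
Proof.
case: k hk => // n _; have [T TP] := solution_operator n c hbeta; exists T.
have sT f : L2w f -> L2s (-1) (T f) by move/TP => [].
have solT f : L2w f -> weak_sol n c beta f (T f) by move/TP => [].
have minT f : L2w f -> minimal n c beta (T f) by move/TP => [].
have fact0 : 0 <= (n.+1)`!%:R^-1 :> R by rewrite invr_ge0.
have normT f : L2w f -> (normw (T f) <= (Num.sqrt (n.+1)`!%:R^-1)%:E * normw f)%E.
  move=> wf; rewrite (normwE (sT f wf)) (normwE (L2w_L2s wf)) -EFinM lee_fin -sqrtrM//.
  by rewrite ler_wsqrtr// mulrC; case: (TP _ wf).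
have wlin (a : R[i]) f g : L2w f -> L2w g -> L2w (a *: f + g).
  by move=> /L2w_L2s sf /L2w_L2s sg; apply: L2s_L2w; exact: L2s_lin.
have w0 : L2w (0 : R[i] -> R[i]) by apply/L2s_L2w/test_L2s/test0.
split.
- split=> [f wf|f g wf wg fg|a f g wf wg]; first exact/L2s_L2w/sT.
    (* Almost everywhere equal data have the same pairings with test functions, hence the same
       minimal solution. *)
    apply: (@minimal_unique _ n c beta); [exact: sT|exact: sT|exact: minT|exact: minT|].
    move=> phi tp; rewrite solT// solT//; apply: ip_ae_equal fg; [exact: L2w_L2s..|].
    by apply/L2s_conj_gauss/test_L2s.
  have wfg := wlin a f g wf wg.
  apply: (@minimal_unique _ n c beta (T (a *: f + g)) (a *: T f + T g)).
  + exact: sT.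
  + by apply: L2s_lin; exact: sT.
  + exact: minT.
  + by apply: minimal_lin; [exact: sT|exact: sT|exact: minT|exact: minT].
  move=> phi tp; rewrite solT//.
  by rewrite (weak_sol_lin _ _ _ _ _ (solT f wf) (solT g wg))//;
    [exact: L2w_L2s|exact: L2w_L2s|exact: sT|exact: sT].
- by exists (Num.sqrt (n.+1)`!%:R^-1).
- by move=> f wf; apply: weak_sol_weak_solution => //; [exact/L2s_L2w/sT|exact: solT].
have op_le : (opnorm T <= (Num.sqrt (n.+1)`!%:R^-1)%:E)%E.
  apply: ge_ereal_sup => _ [f [wf f1] <-]; apply: le_trans (normT f wf) _.
  by rewrite -[leRHS]mule1 lee_wpmul2l// lee_fin sqrtr_ge0.
(* The zero function lies in the unit ball, so the supremum is nonnegative and its bound may be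
   squared. *)
have op_ge0 : (0 <= opnorm T)%E.
  apply: le_trans (poweR_ge0 (sqnormw (T 0)) 2^-1) _.
  apply: ereal_sup_ubound; exists 0 => //; split=> //.
  rewrite (normwE (L2w_L2s w0)) lee_fin (_ : ip _ _ _ = 0) ?sqrtr0//.
  by rewrite (ip0 (@L2s_lin R (-1)) (@ip_lin R (-1)) (L2w_L2s w0)).
rewrite -[X in (_ <= X%:E)%E]sqr_sqrtr// EFin_expe.
by rewrite expe2 expe2 lee_pmul.
Qed.
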